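(* Let $U$ be a vector space over $\mathbb{C}$, let $A=S(\mathbb{C}[\partial]\otimes U)$ be the free differential algebra over $U$, and let $Y_-^0$ be a weak pre-vertex-Poisson structure on $A$ such that for $u,v,w$ from an ordered basis of $U$ with $u\le v\le w$, $$\tilde{Y}_-^0(u,x_1)Y_-^0(v,x_2)w-\tilde{Y}_-^0(v,x_2)Y_-^0(u,x_1)w=\mathrm{Sing}\left(e^{x_2\partial}\tilde{Y}_-^0(w,-x_2)Y_-^0(u,x_1-x_2)v\right),$$ where for $u\in U$, $\tilde{Y}_-^0(u,x)\in x^{-1}(\mathrm{Der}\,A)[[x^{-1}]]$ is uniquely determined by $$\tilde{Y}_-^0(u,x)e^{x_1\partial}v=e^{x_1\partial}e^{-x_1\frac{d}{dx}}Y_-^0(u,x)v\quad\text{for }v\in U.$$ Then $Y_-^0$ uniquely extends to a vertex Poisson algebra structure $Y_-$ on the differential algebra $(A,\partial)$.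
   Context: A differential algebra is a commutative associative $\mathbb{C}$-algebra $A$ with identity $1$ equipped with a derivation $\partial$. $\mathrm{Der}\,A$ is the space of derivations of the commutative algebra $A$. The free differential algebra over $U$ is the symmetric algebra $A=S(\mathbb{C}[\partial]\otimes U)$, where $\partial$ acts on the free $\mathbb{C}[\partial]$-module $\mathbb{C}[\partial]\otimes U$ and is extended uniquely to a derivation of $A$; $U$ is identified with $1\otimes U$ and $\partial^iu$ denotes $\partial^i\otimes u$. For a formal series $f(x_1,\dots,x_n)=\sum_{m_1,\dots,m_n\in\mathbb{Z}}u(m_1,\dots,m_n)x_1^{-m_1-1}\cdots x_n^{-m_n-1}$, $\mathrm{Sing} f=\sum_{m_1,\dots,m_n\ge0}u(m_1,\dots,m_n)x_1^{-m_1-1}\cdots x_n^{-m_n-1}$. Negative powers of $x_1-x_2$ are expanded in nonnegative powers of $x_2$. A weak pre-vertex-Poisson structure on $A$ is a bilinear map $Y_-^0:U\times U\to x^{-1}A[x^{-1}]$, $(u,v)\mapsto Y_-^0(u,x)v$, such that $Y_-^0(u,x)v=\mathrm{Sing}\left(e^{x\partial}Y_-^0(v,-x)u\right)$ for $u,v\in U$. Vertex Lie algebra: a vector space $A$ with a linear operator $\partial$ and bilinear products $(a,b)\mapsto a_nb$ ($n\in\mathbb{N}=\{0,1,2,\dots\}$) such that for $a,b,c\in A$, $m,n\in\mathbb{N}$: (C0) $a_nb=0$ for $n$ sufficiently large; (C1) $(\partial a)_nb=-n\,a_{n-1}b$ (which is $0$ for $n=0$); (C2) $a_nb=\sum_{i\ge0}(-1)^{n+i+1}\frac{1}{i!}\partial^i(b_{n+i}a)$;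 (C3) $a_mb_nc-b_na_mc=\sum_{i=0}^m\binom{m}{i}(a_ib)_{m+n-i}c$. One writes $Y_-(a,x)=\sum_{n\ge0}a_nx^{-n-1}$. Vertex Poisson algebra: a differential algebra $(A,\partial)$ with a vertex Lie algebra structure $(Y_-,\partial)$ (same $\partial$) such that $a_n(bc)=(a_nb)c+b(a_nc)$ for all $a,b,c\in A$, $n\ge0$. That $Y_-$ extends $Y_-^0$ means $Y_-(u,x)v=Y_-^0(u,x)v$ for $u,v\in U$. *)

(* Defs.v *)
From HB Require Import structures.
From mathcomp Require Import all_boot all_order all_algebra.
From mathcomp Require Import generic_quotient.
From mathcomp Require Import mathcomp_extra boolp classical_sets functions.
From mathcomp Require Import cardinality fsbigop reals complex.
Set Implicit Arguments.
Unset Strict Implicit.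
Unset Printing Implicit Defensive.
Import Order.TTheory GRing.Theory Num.Theory.
Local Open Scope classical_set_scope.
Local Open Scope quotient_scope.
Local Open Scope ring_scope.

(* S(M) is presented as the commutative K-algebra generated by the symbols
   [SGen m], m in M, subject to linearity in m: terms modulo the smallest
   congruence [scong] containing these relations and the axioms of
   commutative K-algebras.  Lemma [symalg_univ] is its universal property. *)
Section SymAlg.
Variables (K : fieldType) (M : lmodType K).

Inductive sterm : Type :=
| SGen of M
| SConst of K
| SAdd of sterm & sterm
| SMul of sterm & sterm.

Inductive scong : sterm -> sterm -> Prop :=
| scong_refl x : scong x x
| scong_sym x y : scong x y -> scong y x
| scong_trans x y z : scong x y -> scong y z -> scong x z
| scong_add x x' y y' :
    scong x x' -> scong y y' -> scong (SAdd x y) (SAdd x' y')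
| scong_mul x x' y y' :
    scong x x' -> scong y y' -> scong (SMul x y) (SMul x' y')
| scong_addA x y z : scong (SAdd x (SAdd y z)) (SAdd (SAdd x y) z)
| scong_addC x y : scong (SAdd x y) (SAdd y x)
| scong_add0 x : scong (SAdd (SConst 0) x) x
| scong_mulA x y z : scong (SMul x (SMul y z)) (SMul (SMul x y) z)
| scong_mulC x y : scong (SMul x y) (SMul y x)
| scong_mul1 x : scong (SMul (SConst 1) x) x
| scong_mul0 x : scong (SMul (SConst 0) x) (SConst 0)
| scong_mulD x y z : scong (SMul (SAdd x y) z) (SAdd (SMul x z) (SMul y z))
| scong_constD a b : scong (SConst (a + b)) (SAdd (SConst a) (SConst b))
| scong_constM a b : scong (SConst (a * b)) (SMul (SConst a) (SConst b))
| scong_genD m n : scong (SGen (m + n)) (SAdd (SGen m) (SGen n))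
| scong_genZ a m : scong (SGen (a *: m)) (SMul (SConst a) (SGen m)).

HB.instance Definition _ := gen_eqMixin sterm.
HB.instance Definition _ := gen_choiceMixin sterm.

Definition scongb (x y : sterm) : bool := `[< scong x y >].

Lemma scongb_equiv : equiv_class_of scongb.
Proof.
split=> [x|x y|y x z].
- by apply/asboolP; exact: scong_refl.
- by apply/asboolP/asboolP; exact: scong_sym.
- by move=> /asboolP h1 /asboolP h2; apply/asboolP; exact: scong_trans h1 h2.
Qed.

Canonical scongb_equiv_rel := EquivRelPack scongb_equiv.

Definition symalg := {eq_quot scongb_equiv_rel}.

HB.instance Definition _ := Choice.on symalg.

Definition sym_pi (x : sterm) : symalg := \pi_symalg x.

Lemma sym_piP (x y : sterm) : sym_pi x = sym_pi y <-> scong x y.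
Proof.
split=> [/eqquotP /asboolP //|h].
by apply/eqquotP/asboolP.
Qed.

Lemma sym_pi_repr (a : symalg) : sym_pi (repr a) = a.
Proof. by rewrite /sym_pi reprK. Qed.

Lemma sym_ind (P : symalg -> Prop) :
  (forall x, P (sym_pi x)) -> forall a, P a.
Proof. by move=> h a; rewrite -[a]sym_pi_repr. Qed.

Lemma repr_sym_pi x : scong (repr (sym_pi x)) x.
Proof. by apply/sym_piP; rewrite sym_pi_repr. Qed.

Definition sym_add (a b : symalg) := sym_pi (SAdd (repr a) (repr b)).
Definition sym_mul (a b : symalg) := sym_pi (SMul (repr a) (repr b)).
Definition sym_const (c : K) := sym_pi (SConst c).
Definition sym_opp (a : symalg) := sym_mul (sym_const (-1)) a.
Definition sym_scale (c : K) (a : symalg) := sym_mul (sym_const c) a.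
Definition sym_in (m : M) := sym_pi (SGen m).

Lemma sym_piD x y : sym_pi (SAdd x y) = sym_add (sym_pi x) (sym_pi y).
Proof. by apply/sym_piP/scong_sym/scong_add; exact: repr_sym_pi. Qed.

Lemma sym_piM x y : sym_pi (SMul x y) = sym_mul (sym_pi x) (sym_pi y).
Proof. by apply/sym_piP/scong_sym/scong_mul; exact: repr_sym_pi. Qed.

Let addA : associative sym_add.
Proof.
elim/sym_ind=> x; elim/sym_ind=> y; elim/sym_ind=> z.
by rewrite -!sym_piD; apply/sym_piP/scong_addA.
Qed.

Let addC : commutative sym_add.
Proof.
elim/sym_ind=> x; elim/sym_ind=> y.
by rewrite -!sym_piD; apply/sym_piP/scong_addC.
Qed.

Let add0 : left_id (sym_const 0) sym_add.
Proof.
by elim/sym_ind=> x; rewrite -!sym_piD; apply/sym_piP/scong_add0.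
Qed.

Let mulA : associative sym_mul.
Proof.
elim/sym_ind=> x; elim/sym_ind=> y; elim/sym_ind=> z.
by rewrite -!sym_piM; apply/sym_piP/scong_mulA.
Qed.

Let mulC : commutative sym_mul.
Proof.
elim/sym_ind=> x; elim/sym_ind=> y.
by rewrite -!sym_piM; apply/sym_piP/scong_mulC.
Qed.

Let mul1 : left_id (sym_const 1) sym_mul.
Proof.
by elim/sym_ind=> x; rewrite -!sym_piM; apply/sym_piP/scong_mul1.
Qed.

Let mul0 : left_zero (sym_const 0) sym_mul.
Proof.
by elim/sym_ind=> x; rewrite -!sym_piM; apply/sym_piP/scong_mul0.
Qed.

Let mulD : left_distributive sym_mul sym_add.
Proof.
elim/sym_ind=> x; elim/sym_ind=> y; elim/sym_ind=> z.
by rewrite -!(sym_piM, sym_piD); apply/sym_piP/scong_mulD.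
Qed.

Let constD a b : sym_const (a + b) = sym_add (sym_const a) (sym_const b).
Proof. by rewrite -sym_piD; apply/sym_piP/scong_constD. Qed.

Let constM a b : sym_const (a * b) = sym_mul (sym_const a) (sym_const b).
Proof. by rewrite -sym_piM; apply/sym_piP/scong_constM. Qed.

Let addN : left_inverse (sym_const 0) sym_opp sym_add.
Proof.
move=> a; rewrite /sym_opp -{2}[a]mul1 -mulD -constD addrC subrr.
exact: mul0.
Qed.

(* The augmentation S(M) -> K; it only serves to prove 1 != 0. *)
Fixpoint saug (x : sterm) : K :=
  match x with
  | SGen _ => 0
  | SConst c => c
  | SAdd x y => saug x + saug y
  | SMul x y => saug x * saug y
  end.

Let saugP x y : scong x y -> saug x = saug y.
Proof.
elim=> //=.
- by move=> *; congruence.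
- by move=> ? ? ? ? _ -> _ ->.
- by move=> ? ? ? ? _ -> _ ->.
- by move=> *; rewrite addrA.
- by move=> *; rewrite addrC.
- by move=> *; rewrite add0r.
- by move=> *; rewrite mulrA.
- by move=> *; rewrite mulrC.
- by move=> *; rewrite mul1r.
- by move=> *; rewrite mul0r.
- by move=> *; rewrite mulrDl.
- by move=> *; rewrite addr0.
- by move=> *; rewrite mulr0.
Qed.

Let one_neq0 : sym_const 1 != sym_const 0.
Proof.
apply/eqP => /sym_piP /saugP /= /eqP.
by rewrite oner_eq0.
Qed.

HB.instance Definition _ := GRing.isZmodule.Build symalg addA addC add0 addN.
HB.instance Definition _ := GRing.Zmodule_isComNzRing.Build symalg
  mulA mulC mul1 mulD one_neq0.

Let scaleA a b v : sym_scale a (sym_scale b v) = sym_scale (a * b) v.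
Proof. by rewrite /sym_scale constM mulA. Qed.
Let scale1 : left_id 1 sym_scale.
Proof. exact: mul1. Qed.
Let scaleDr : right_distributive sym_scale +%R.
Proof.
move=> c a b; rewrite /sym_scale.
exact: (mulrDr (sym_const c : symalg)).
Qed.
Let scaleDl v : {morph sym_scale^~ v : a b / a + b}.
Proof. by move=> a b; rewrite /sym_scale constD; exact: mulD. Qed.

HB.instance Definition _ := GRing.Zmodule_isLmodule.Build K symalg
  scaleA scale1 scaleDr scaleDl.

Let scaleAl (c : K) (a b : symalg) : c *: (a * b) = (c *: a) * b.
Proof. exact: mulA. Qed.

HB.instance Definition _ := GRing.Lmodule_isLalgebra.Build K symalg scaleAl.
HB.instance Definition _ := GRing.Lalgebra_isComAlgebra.Build K symalg.

Lemma sym_piDE x y : sym_pi (SAdd x y) = sym_pi x + sym_pi y.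
Proof. exact: sym_piD. Qed.
Lemma sym_piME x y : sym_pi (SMul x y) = sym_pi x * sym_pi y.
Proof. exact: sym_piM. Qed.
Lemma sym_piCE c : sym_pi (SConst c) = c%:A.
Proof. by rewrite -[LHS]mulr1. Qed.

Lemma sym_in_linear : linear sym_in.
Proof.
move=> a m n.
have -> : sym_in (a *: m + n) = sym_pi (SAdd (SGen (a *: m)) (SGen n)).
  by apply/sym_piP/scong_genD.
rewrite sym_piDE; congr (_ + _).
have -> : sym_pi (SGen (a *: m)) = sym_pi (SMul (SConst a) (SGen m)).
  by apply/sym_piP/scong_genZ.
by rewrite sym_piME sym_piCE mulr_algl.
Qed.

HB.instance Definition _ := GRing.isLinear.Build K M symalg *:%R sym_in
  sym_in_linear.

Section Lift.
Variables (B : comAlgType K) (f : {linear M -> B}).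

Fixpoint slift (x : sterm) : B :=
  match x with
  | SGen m => f m
  | SConst c => c%:A
  | SAdd x y => slift x + slift y
  | SMul x y => slift x * slift y
  end.

Let sliftP x y : scong x y -> slift x = slift y.
Proof.
elim=> //=.
- by move=> *; congruence.
- by move=> ? ? ? ? _ -> _ ->.
- by move=> ? ? ? ? _ -> _ ->.
- by move=> *; rewrite addrA.
- by move=> *; rewrite addrC.
- by move=> *; rewrite scale0r add0r.
- by move=> *; rewrite mulrA.
- by move=> *; rewrite mulrC.
- by move=> *; rewrite scale1r mul1r.
- by move=> *; rewrite scale0r mul0r.
- by move=> *; rewrite mulrDl.
- by move=> *; rewrite scalerDl.
- by move=> *; rewrite mulr_algl scalerA.
- by move=> *; rewrite linearD.
- by move=> *; rewrite linearZ mulr_algl.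
Qed.

Definition sym_lift (a : symalg) : B := slift (repr a).

Lemma sym_liftE x : sym_lift (sym_pi x) = slift x.
Proof. exact/sliftP/repr_sym_pi. Qed.

Let lift_linear : linear sym_lift.
Proof.
move=> c; elim/sym_ind=> x; elim/sym_ind=> y.
rewrite -mulr_algl -sym_piCE -sym_piME -sym_piDE !sym_liftE /=.
by rewrite mulr_algl.
Qed.

Let lift_monoid : monoid_morphism sym_lift.
Proof.
split; first by rewrite -[1]scale1r -sym_piCE sym_liftE /= scale1r.
elim/sym_ind=> x; elim/sym_ind=> y.
by rewrite -sym_piME !sym_liftE.
Qed.

HB.instance Definition _ := GRing.isLinear.Build K symalg B *:%R sym_lift
  lift_linear.
HB.instance Definition _ := GRing.isMonoidMorphism.Build symalg B sym_lift
  lift_monoid.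

Lemma symalg_univ : exists g : {lrmorphism symalg -> B},
  (forall m, g (sym_in m) = f m) /\
  forall h : {lrmorphism symalg -> B},
    (forall m, h (sym_in m) = f m) -> h =1 g.
Proof.
exists sym_lift; split=> [m|h hf]; first by rewrite /= sym_liftE.
elim/sym_ind; elim=> [m|c|x ihx y ihy|x ihx y ihy].
- by rewrite [LHS]hf /= sym_liftE.
- by rewrite sym_piCE !rmorph_alg.
- by rewrite sym_piDE !rmorphD; congr (_ + _).
- by rewrite sym_piME !rmorphM; congr (_ * _).
Qed.

End Lift.
End SymAlg.

Section Derivations.
Variable K : fieldType.

Definition is_derivation (A : comAlgType K) (d : A -> A) : Prop :=
  linear d /\ forall a b, d (a * b) = d a * b + a * d b.

Lemma derivation_alg (A : comAlgType K) (d : A -> A) (c : K) :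
  is_derivation d -> d c%:A = 0.
Proof.
move=> [dlin dM]; have d0 : d 0 = 0.
  by move: (dlin (-1) 0 0); rewrite scaler0 addr0 scaleN1r addNr.
have d1 : d 1 = 0.
  move: (dM 1 1); rewrite !mulr1 mul1r => /eqP.
  by rewrite -subr_eq subrr eq_sym => /eqP.
by rewrite -[c%:A]addr0 dlin d1 d0 scaler0 addr0.
Qed.

Variable M : lmodType K.
Notation S := (symalg M).

Lemma symder_uniq (d d' : S -> S) : is_derivation d -> is_derivation d' ->
  (forall m, d (sym_in m) = d' (sym_in m)) -> d = d'.
Proof.
move=> dd dd' e; apply/funext; elim/sym_ind.
have [[dl dm] [dl' dm']] := (dd, dd').
elim=> [m|c|x ihx y ihy|x ihx y ihy]; first exact: e.
- by rewrite sym_piCE !derivation_alg.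
- by rewrite sym_piDE -[sym_pi x]scale1r dl dl' ihx ihy.
- by rewrite sym_piME dm dm' ihx ihy.
Qed.

(* [symder D] is the derivation of S(M) extending the linear map
   [D : M -> S(M)]. *)
Section SymDer.
Variable D : {linear M -> S}.

Fixpoint tder (x : sterm M) : S :=
  match x with
  | SGen m => D m
  | SConst _ => 0
  | SAdd x y => tder x + tder y
  | SMul x y => tder x * sym_pi y + sym_pi x * tder y
  end.

Let tderP x y : scong x y -> tder x = tder y.
Proof.
elim=> /=.
- by [].
- by [].
- by move=> *; congruence.
- by move=> ? ? ? ? _ -> _ ->.
- by move=> a b a' b' /sym_piP -> -> /sym_piP -> ->.
- by move=> *; rewrite addrA.
- by move=> *; rewrite addrC.
- by move=> *; rewrite add0r.
- by move=> *; rewrite !sym_piME !mulrDr !mulrDl !mulrA !addrA.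
- by move=> x0 y0; rewrite addrC; congr (_ + _); rewrite mulrC.
- by move=> *; rewrite sym_piCE scale1r mul0r mul1r add0r.
- by move=> *; rewrite sym_piCE scale0r !mul0r addr0.
- by move=> *; rewrite sym_piDE !mulrDl addrACA.
- by move=> *; rewrite addr0.
- by move=> *; rewrite mul0r mulr0 addr0.
- by move=> *; rewrite linearD.
- by move=> *; rewrite linearZ mul0r add0r sym_piCE mulr_algl.
Qed.

Definition symder (a : S) : S := tder (repr a).

Let symder_pi x : symder (sym_pi x) = tder x.
Proof. exact/tderP/repr_sym_pi. Qed.

Lemma symder_in m : symder (sym_in m) = D m.
Proof. exact: symder_pi. Qed.

Lemma symder_derivation : is_derivation symder.
Proof.
split=> [c|]; elim/sym_ind=> x; elim/sym_ind=> y.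
  rewrite -mulr_algl -sym_piCE -sym_piME -sym_piDE !symder_pi /=.
  by rewrite mul0r add0r sym_piCE mulr_algl.
by rewrite -sym_piME !symder_pi.
Qed.

End SymDer.
End Derivations.

Section FreeDiffAlg.
Variables (K : fieldType) (U : lmodType K).

(* C[d] (x) U is represented by polynomials in d with coefficients in U:
   [f : dmod U] stands for the finite sum of the d^i (x) (f i). *)
Definition finsupp : {pred nat -> U} :=
  fun f => `[< exists N, forall n, (N <= n)%N -> f n = 0 >].

Lemma finsupp_submod : submod_closed finsupp.
Proof.
split=> [|c f g /asboolP [N hN] /asboolP [P hP]]; apply/asboolP.
  by exists 0%N.
exists (maxn N P) => n; rewrite geq_max => /andP [h1 h2].
by rewrite !fctE hN // hP // scaler0 addr0.
Qed.
HB.instance Definition _ := GRing.isSubmodClosed.Build K (nat -> U) finsupp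
  finsupp_submod.

Record dmod := Dmod { dcoef :> nat -> U; _ : dcoef \in finsupp }.
HB.instance Definition _ := [isSub for dcoef].
HB.instance Definition _ := [Choice of dmod by <:].
HB.instance Definition _ := [SubChoice_isSubLmodule of dmod by <:].

Definition dshift_fun (f : nat -> U) (n : nat) : U :=
  if n is n'.+1 then f n' else 0.

Lemma dshift_proof (f : dmod) : dshift_fun f \in finsupp.
Proof.
case: f => f /= /asboolP [N hN]; apply/asboolP.
by exists N.+1 => -[//|n]; exact: hN.
Qed.
Definition dshift (f : dmod) : dmod := Dmod (dshift_proof f).

Lemma dmodP (f g : dmod) : (forall n, f n = g n) -> f = g.
Proof. by move=> h; apply/val_inj/funext. Qed.

Lemma dshift_linear : linear dshift.
Proof.
by move=> c f g; apply: dmodP => -[|n] //=; rewrite !fctE /= scaler0 addr0.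
Qed.
HB.instance Definition _ := GRing.isLinear.Build K dmod dmod *:%R dshift
  dshift_linear.

Lemma dmono_proof (u : U) : (fun n => if n is 0 then u else 0) \in finsupp.
Proof. by apply/asboolP; exists 1%N => -[]. Qed.
Definition dmono0 (u : U) : dmod := Dmod (dmono_proof u).

Lemma dmono0_linear : linear dmono0.
Proof.
by move=> c f g; apply: dmodP => -[|n] //=; rewrite !fctE /= scaler0 addr0.
Qed.
HB.instance Definition _ := GRing.isLinear.Build K U dmod *:%R dmono0
  dmono0_linear.

Definition fdalg := symalg dmod.
HB.instance Definition _ := GRing.ComAlgebra.on fdalg.

Definition fd_in (u : U) : fdalg := sym_in (dmono0 u).

Definition fd_der : fdalg -> fdalg := symder (@sym_in _ _ \o dshift).

Lemma fd_der_derivation : is_derivation fd_der.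
Proof. exact: symder_derivation. Qed.

Lemma fd_der_in (f : dmod) : fd_der (sym_in f) = sym_in (dshift f).
Proof. exact: symder_in. Qed.

End FreeDiffAlg.

(* A formal series f(x) = \sum_(m : int) u(m) x^(-m-1) is encoded by its modes
   [u : int -> V], and similarly f(x1, x2) by [u : int -> int -> V].
   [\sum_(i \in _)] is the sum of a finitely supported family (fsbigop). *)
Section Series.
Variables (K : fieldType) (V : lmodType K).
Implicit Types (f : int -> V) (g : int -> int -> V) (d : V -> V).

Definition Sing f : int -> V := fun m => if 0 <= m then f m else 0.

Definition Sing2 g : int -> int -> V :=
  fun m n => if (0 <= m) && (0 <= n) then g m n else 0.

(* f lies in x^-1 V[x^-1] *)
Definition polar f : Prop :=
  (forall m, m < 0 -> f m = 0) /\ exists N : int, forall m, N <= m -> f m = 0.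

(* f(-x) *)
Definition xneg f : int -> V := fun m => (-1 : K) ^ (- m - 1) *: f m.

(* (d/dx) f *)
Definition ddx f : int -> V := fun m => (- m)%:~R *: f (m - 1).

(* e^(x d) f *)
Definition expx d f : int -> V :=
  fun m => \sum_(i \in [set: nat]) (i`!%:R : K)^-1 *: iter i d (f (m + i%:Z)).

Definition gbinom (c : K) (j : nat) : K :=
  (\prod_(i < j) (c - i%:R)) / j`!%:R.

(* f(x1 - x2), where for k : int
   (x1 - x2)^(-k-1) = \sum_(j >= 0) gbinom (-k-1) j x1^(-k-1-j) (-x2)^j;
   the coefficient of x1^(-m-1) x2^j thus comes from k = m - j, and
   x2^j has mode n = -j-1 = Negz j. *)
Definition xsub f : int -> int -> V := fun m n =>
  if n is Negz j then
    ((-1) ^+ j * gbinom (- (m - j%:Z) - 1)%:~R j) *: f (m - j%:Z)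
  else 0.

(* T(x2) g(x1, x2) for a series T(x) = \sum_k T_k x^(-k-1) of operators *)
Definition xapp2 (T : int -> V -> V) g : int -> int -> V :=
  fun m n => \sum_(k \in [set: int]) T k (g m (n - k - 1)).

(* Power series in a variable x1 (here [h n] is the coefficient of x1^n):
   constants, and e^(x1 d) h. *)
Definition pconst (v : V) : nat -> V := fun n => if n is 0 then v else 0.

Definition pexp d (h : nat -> V) : nat -> V :=
  fun n => \sum_(i < n.+1) (i`!%:R : K)^-1 *: iter i d (h (n - i)%N).

End Series.

Section VertexPoisson.
Variable K : fieldType.

(* [prod n a b] is a_n b. *)
Record vertex_lie (V : lmodType K) (d : V -> V) (prod : nat -> V -> V -> V) :
    Prop := VertexLie {
  vl_d : linear d;
  vl_linl : forall n b, linear (fun a => prod n a b);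
  vl_linr : forall n a, linear (prod n a);
  vl_C0 : forall a b, exists N, forall n, (N <= n)%N -> prod n a b = 0;
  vl_C1 : forall n a b, prod n (d a) b = (- n%:R) *: prod n.-1 a b;
  vl_C2 : forall n a b, prod n a b =
    \sum_(i \in [set: nat]) ((-1) ^+ (n + i + 1) * (i`!%:R : K)^-1) *:
      iter i d (prod (n + i)%N b a);
  vl_C3 : forall m n a b c,
    prod m a (prod n b c) - prod n b (prod m a c) =
    \sum_(i < m.+1) 'C(m, i)%:R *: prod (m + n - i)%N (prod i a b) c
}.

Record vertex_poisson (A : comAlgType K) (d : A -> A)
    (prod : nat -> A -> A -> A) : Prop := VertexPoisson {
  vp_d : is_derivation d;
  vp_lie : vertex_lie d prod;
  vp_leibniz : forall n a b c,
    prod n a (b * c) = prod n a b * c + b * prod n a c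
}.

(* Y_-(a, x) b = \sum_(n >= 0) (a_n b) x^(-n-1) *)
Definition Yminus (V : Type) (W : zmodType) (prod : nat -> V -> V -> W)
    (a b : V) : int -> W :=
  fun m => if m is Posz n then prod n a b else 0.

(* [Y0 u v] is the series Y_-^0(u, x) v. *)
Record weak_pre_vertex_poisson (U : lmodType K) (A : comAlgType K)
    (d : A -> A) (Y0 : U -> U -> int -> A) : Prop := WeakPreVertexPoisson {
  wp_linl : forall v, linear (fun u => Y0 u v);
  wp_linr : forall u, linear (Y0 u);
  wp_polar : forall u v, polar (Y0 u v);
  wp_skew : forall u v, Y0 u v = Sing (expx d (xneg (Y0 v u)))
}.

(* [Yt u] is a series in x^-1 (Der A)[[x^-1]] such that
   Yt(u, x) e^(x1 d) v = e^(x1 d) e^(- x1 d/dx) Y0(u, x) v, an equality of power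
   series in x1; [iota] is the embedding of U in A. *)
Definition is_Ytilde (U : lmodType K) (A : comAlgType K) (iota : U -> A)
    (d : A -> A) (Y0 : U -> U -> int -> A) (Yt : U -> int -> A -> A) : Prop :=
  forall u,
  [/\ forall m, is_derivation (Yt u m),
      forall m, m < 0 -> Yt u m = 0 &
      forall v, (fun n m => Yt u m (pexp d (pconst (iota v)) n)) =
        pexp (fun f : int -> A => d \o f)
          (pexp (fun f : int -> A => - ddx f) (pconst (Y0 u v)))].

(* Yt(u,x1) Y0(v,x2) w - Yt(v,x2) Y0(u,x1) w
     = Sing (e^(x2 d) Yt(w,-x2) Y0(u,x1-x2) v) *)
Definition commutator_identity (U : lmodType K) (A : comAlgType K)
    (d : A -> A) (Y0 : U -> U -> int -> A) (Yt : U -> int -> A -> A)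
    (u v w : U) : Prop :=
  (fun m n : int => Yt u m (Y0 v w n) - Yt v n (Y0 u w m)) =
  Sing2 (fun m => expx d (xapp2 (xneg (Yt w)) (xsub (Y0 u v)) m)).

Definition is_basis (U : lmodType K) (I : eqType) (e : I -> U) : Prop :=
  (forall (s : seq I) (c : I -> K), uniq s ->
     \sum_(i <- s) c i *: e i = 0 -> forall i, i \in s -> c i = 0) /\
  (forall u, exists (s : seq I) (c : I -> K), u = \sum_(i <- s) c i *: e i).

End VertexPoisson.

Section YtildeExists.
Variables (K : numFieldType) (U : lmodType K).
Notation A := (fdalg U).
Notation der := (@fd_der K U).
Variable Y0 : U -> U -> int -> A.
Hypothesis Y0_linr : forall u, linear (Y0 u).
Hypothesis Y0_neg : forall u v m, m < 0 -> Y0 u v m = 0.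

Let fact_neq0 n : n`!%:R != 0 :> K.
Proof. by rewrite pnatr_eq0 -lt0n fact_gt0. Qed.

Let pexp_const (V : lmodType K) (d : V -> V) (v : V) n :
  (forall k, iter k d 0 = 0) ->
  pexp d (pconst v) n = (n`!%:R : K)^-1 *: iter n d v.
Proof.
move=> d0; rewrite /pexp big_ord_recr /= subnn big1 ?add0r // => i _.
have : (0 < n - i)%N by rewrite subn_gt0.
by case: (n - i)%N => //= k _; rewrite d0 scaler0.
Qed.

Let iter_linear (V : lmodType K) (d : V -> V) k : linear d -> linear (iter k d).
Proof. by move=> h; elim: k => [//|k ih] c x y /=; rewrite ih h. Qed.

Let lin0 (V W : lmodType K) (d : V -> W) : linear d -> d 0 = 0.
Proof. by move=> h; move: (h (-1) 0 0); rewrite scaler0 addr0 scaleN1r addNr. Qed.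

Let pexp_linear (V : lmodType K) (d : V -> V) n : linear d ->
  linear (fun h : nat -> V => pexp d h n).
Proof.
move=> dl c h h'; rewrite /pexp scaler_sumr -big_split; apply: eq_bigr => i _ /=.
by rewrite !fctE iter_linear // scalerDr !scalerA mulrC.
Qed.

Let rhs (u v : U) : nat -> int -> A :=
  pexp (fun f : int -> A => der \o f)
    (pexp (fun f : int -> A => - ddx f) (pconst (Y0 u v))).

Let der_lin : linear der. Proof. exact: (fd_der_derivation U).1. Qed.

Let derf_lin : linear (fun f : int -> A => der \o f).
Proof. by move=> c f g; apply/funext => m /=; rewrite !fctE /= der_lin. Qed.

Let ddx_lin : linear (fun f : int -> A => - ddx f).
Proof.
move=> c f g; apply/funext => m; rewrite /ddx /= !fctE /=.
by rewrite scalerDr opprD scalerN !scalerA mulrC.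
Qed.

Let pexp_fun_linear (V : lmodType K) (d : V -> V) : linear d -> linear (pexp d).
Proof. by move=> dl c h h'; apply/funext => n; exact: pexp_linear. Qed.

Let rhs_lin u n m : linear (fun v => rhs u v n m).
Proof.
move=> c v v'; rewrite /rhs.
have -> : pconst (Y0 u (c *: v + v')) =
    c *: pconst (Y0 u v) + pconst (Y0 u v').
  apply/funext => -[|k]; first exact: Y0_linr.
  by transitivity (c *: (0 : int -> A) + 0); first by rewrite scaler0 addr0.
by rewrite pexp_fun_linear // pexp_linear.
Qed.

Let rhs_neg u v n m : m < 0 -> rhs u v n m = 0.
Proof.
move=> m0.
have h1 k : forall m : int, m < 0 -> iter k (fun f : int -> A => - ddx f) (Y0 u v) m = 0.
  elim: k => [|k ih] p p0 /=; first exact: Y0_neg.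
  rewrite /ddx fctE ih ?scaler0 ?oppr0 //.
  by apply: le_lt_trans p0; rewrite gerBl.
rewrite /rhs /pexp fct_sumE; apply: big1 => i _.
have h2 k (f : int -> A) p : f p = 0 -> iter k (fun f : int -> A => der \o f) f p = 0.
  by elim: k => [//|k ih] f0 /=; rewrite ih // lin0.
rewrite fctE h2 ?scaler0 //.
have := @pexp_const _ (fun f : int -> A => - ddx f) (Y0 u v) (n - i)%N.
rewrite /pexp => ->; last by move=> k; apply/lin0/iter_linear.
by rewrite fctE h1 // scaler0.
Qed.

Let dbound (f : dmod U) : nat := projT1 (cid (elimT (asboolP _) (valP f))).

Let dboundP (f : dmod U) n : (dbound f <= n)%N -> f n = 0.
Proof. exact: (projT2 (cid (elimT (asboolP _) (valP f)))). Qed.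

Let ext u m (f : dmod U) : A :=
  \sum_(i < dbound f) i`!%:R *: rhs u (f i) i m.

Let extE u m (f : dmod U) N : (forall n, (N <= n)%N -> f n = 0) ->
  ext u m f = \sum_(i < N) i`!%:R *: rhs u (f i) i m.
Proof.
move=> fN.
have aux P Q : (P <= Q)%N -> (forall n, (P <= n)%N -> f n = 0) ->
    \sum_(i < P) (i`!%:R : K) *: rhs u (f i) i m =
    \sum_(i < Q) (i`!%:R : K) *: rhs u (f i) i m.
  move=> PQ hP; rewrite -(subnKC PQ) big_split_ord /=.
  rewrite [X in _ = _ + X]big1 ?addr0 // => i _.
  by rewrite hP ?leq_addr // (lin0 (rhs_lin _ _ _)) scaler0.
case: (leqP N (dbound f)) => [le|/ltnW le]; first by rewrite /ext -(aux N).
by rewrite /ext (aux _ N) //; exact: dboundP.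
Qed.

Let ext_linear u m : linear (ext u m).
Proof.
move=> c f g; set N := maxn (dbound f) (dbound g).
have fN n : (N <= n)%N -> f n = 0.
  by rewrite geq_max => /andP [h _]; exact: dboundP.
have gN n : (N <= n)%N -> g n = 0.
  by rewrite geq_max => /andP [_ h]; exact: dboundP.
rewrite (extE _ _ fN) (extE _ _ gN) (@extE _ _ _ N); last first.
  by move=> n Nn; rewrite /= !fctE fN // gN // scaler0 addr0.
rewrite scaler_sumr -big_split; apply: eq_bigr => i _ /=.
by rewrite !fctE rhs_lin scalerDr !scalerA mulrC.
Qed.

HB.instance Definition _ u m :=
  GRing.isLinear.Build K (dmod U) (symalg (dmod U)) *:%R (ext u m)
    (@ext_linear u m).

Let iter_shift i (u : U) n :
  iter i (@dshift K U) (dmono0 u) n = if n == i then u else 0.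
Proof. by elim: i n => [|i ih] [|n] //=; rewrite ih. Qed.

Let iter_der i (f : dmod U) :
  iter i der (sym_in f) = sym_in (iter i (@dshift K U) f).
Proof. by elim: i => [//|i ih] /=; rewrite ih fd_der_in. Qed.

Let sym_in_sum (f : dmod U) :
  sym_in f = \sum_(i < dbound f) iter i der (fd_in (f i)).
Proof.
under eq_bigr do rewrite /fd_in iter_der.
rewrite -linear_sum; congr (sym_in _); apply: dmodP => n.
have -> : forall (s : seq 'I_(dbound f)) (F : 'I_(dbound f) -> dmod U),
    (\sum_(i <- s) F i) n = \sum_(i <- s) F i n.
  move=> s F; elim: s => [|i s ih]; first by rewrite !big_nil.
  by rewrite !big_cons -ih.
under eq_bigr do rewrite iter_shift.
case: (ltnP n (dbound f)) => [h|h].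
  rewrite (bigD1 (Ordinal h)) //= eqxx big1 ?addr0 // => i.
  by rewrite -val_eqE /= eq_sym => /negbTE ->.
rewrite dboundP // big1 // => i _; case: eqP => // e.
by move: (ltn_ord i); rewrite -e ltnNge h.
Qed.

Let Ytilde_eq (d : A -> A) u m : linear d ->
  (forall v n, d (pexp der (pconst (fd_in v)) n) = rhs u v n m) <->
  (forall v n, d (iter n der (fd_in v)) = n`!%:R *: rhs u v n m).
Proof.
move=> dl; have dZ c a : d (c *: a) = c *: d a.
  by rewrite -[c *: a]addr0 dl lin0 // addr0.
have it0 k : iter k der 0 = 0 by apply/lin0/iter_linear.
split=> h v n.
  by rewrite -h pexp_const // dZ scalerA divff // scale1r.
by rewrite pexp_const // dZ h scalerA mulVf // scale1r.
Qed.

Lemma Ytilde_exists_unique :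
  exists! Yt, is_Ytilde (@fd_in K U) der Y0 Yt.
Proof.
exists (fun u m => symder (ext u m)); split.
  move=> u; split.
  - by move=> m; exact: symder_derivation.
  - move=> m m0; apply: symder_uniq.
    + exact: symder_derivation.
    + split=> [c a b|a b]; apply/esym.
        by transitivity (c *: (0 : A) + 0); last by rewrite scaler0 addr0.
      by transitivity ((0 : A) * b + a * 0); last by rewrite mul0r mulr0 addr0.
    + by move=> f; rewrite symder_in /= /ext big1 // => i _; rewrite rhs_neg ?scaler0.
  - move=> v; apply/funext => n; apply/funext => m; move: v n.
    apply/Ytilde_eq; first by case: (symder_derivation (ext u m)).
    move=> v n; rewrite /fd_in iter_der symder_in /= (@extE _ _ _ n.+1).
      rewrite big_ord_recr /= iter_shift eqxx big1 ?add0r // => i _.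
      by rewrite iter_shift ltn_eqF // (lin0 (rhs_lin _ _ _)) scaler0.
    by move=> k nk; rewrite iter_shift gtn_eqF.
move=> Yt h; apply/funext => u; apply/funext => m.
have [hd hn he] := h u; have [hl _] := hd m.
apply: symder_uniq; [exact: symder_derivation|exact: hd|].
move=> f; rewrite symder_in /=.
have hsum : forall N (F : 'I_N -> A), Yt u m (\sum_(i < N) F i) =
    \sum_(i < N) Yt u m (F i).
  elim=> [|N ih] F; first by rewrite !big_ord0 lin0.
  by rewrite !big_ord_recr /= -ih -[X in X + _]scale1r hl scale1r.
rewrite sym_in_sum hsum; apply: eq_bigr => i _; apply/esym.
apply: (Ytilde_eq u m hl).1 => v n.
by have /(congr1 (fun g => g n m)) := he v.
Qed.

End YtildeExists.

(* Main.v *)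
Require Import Defs.
From mathcomp Require Import all_boot all_order all_algebra.
From mathcomp Require Import boolp classical_sets functions fsbigop.
From mathcomp Require Import reals complex ring.
Import Order.TTheory GRing.Theory Num.Theory.
Set Implicit Arguments.
Unset Strict Implicit.
Unset Printing Implicit Defensive.
Local Open Scope ring_scope.

(* Encode the products [a_n b] by the polynomials
   [{a_λ b} = \sum_n λ^n a_n b / n!] over [A].  A bracket that is a derivation in
   its second argument and satisfies [{a_λ (d b)} = (λ + d){a_λ b}] is determined
   by its values at generators in that argument, and on a free differential
   algebra these values can be prescribed.  Since [Yt] gives [{u_λ a}] for [u] in
   [U], skew-symmetry [{a_λ u} = - {u_(-λ-d) a}] forces [{a_λ u}], hence
   [{a_λ b}] for all [b]: this yields uniqueness and defines the bracket.
   Skew-symmetry then holds for all pairs, and it makes the Jacobi identity for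
   [(a, b, c)] invariant under permutations of the triple.  As a function of [c]
   its failure is a derivation, so that it propagates from ordered triples of
   basis elements to all of [A]. *)

(** * Linearity as a predicate on functions *)

Section LinearMaps.
Variables (K : fieldType) (V W : lmodType K) (f : V -> W).
Hypothesis fl : linear f.

Lemma lin_0 : f 0 = 0.
Proof. by move: (fl (-1) 0 0); rewrite scaler0 addr0 scaleN1r addNr. Qed.

Lemma lin_D : {morph f : x y / x + y}.
Proof. by move=> x y; rewrite -[x]scale1r fl !scale1r. Qed.

Lemma lin_Z c : {morph f : x / c *: x}.
Proof. by move=> x; rewrite -[c *: x]addr0 fl lin_0 addr0. Qed.

Lemma lin_N : {morph f : x / - x}.
Proof. by move=> x; rewrite -scaleN1r lin_Z scaleN1r. Qed.

Lemma lin_B : {morph f : x y / x - y}.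
Proof. by move=> x y; rewrite lin_D lin_N. Qed.

Lemma lin_sum (J : Type) (r : seq J) (P : pred J) (F : J -> V) :
  f (\sum_(j <- r | P j) F j) = \sum_(j <- r | P j) f (F j).
Proof. exact: (big_morph f lin_D lin_0). Qed.

End LinearMaps.

Lemma lin_iter (K : fieldType) (V : lmodType K) (f : V -> V) n :
  linear f -> linear (iter n f).
Proof. by move=> fl; elim: n => [//|n ih] c x y /=; rewrite ih fl. Qed.

(** * Polynomials over an algebra, evaluated at scalars *)

Section ScalarEvaluation.
Variables (K : fieldType) (A : comAlgType K).
Implicit Types (p q : {poly A}) (l m : K).

Lemma hornerAX l p (c : A) : (p * 'X + c%:P).[l%:A] = l *: p.[l%:A] + c.
Proof. by rewrite hornerMXaddC mulrC mulr_algl. Qed.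

Section MapLinear.
Variable f : A -> A.
Hypothesis fl : linear f.

Lemma coef_map_lin p n : (map_poly f p)`_n = f p`_n.
Proof. by rewrite coef_map_id0 // lin_0. Qed.

Lemma map_lin0 : map_poly f 0 = 0.
Proof. by apply/polyP => n; rewrite coef_map_lin !coef0 lin_0. Qed.

Lemma map_linD : {morph map_poly f : p q / p + q}.
Proof.
by move=> p q; apply/polyP => n; rewrite !(coefD, coef_map_lin) lin_D.
Qed.

Lemma map_linN : {morph map_poly f : p / - p}.
Proof. by move=> p; apply/polyP => n; rewrite !(coefN, coef_map_lin) lin_N. Qed.

Lemma map_linC c : map_poly f c%:P = (f c)%:P.
Proof.
apply/polyP => n; rewrite coef_map_lin !coefC.
by case: ifP => _; rewrite ?(lin_0 fl).
Qed.

Lemma map_linMX p : map_poly f (p * 'X) = map_poly f p * 'X.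
Proof.
apply/polyP => n; rewrite coef_map_lin !coefMX coef_map_lin.
by case: ifP => _; rewrite ?(lin_0 fl).
Qed.

Lemma horner_map_lin p l : (map_poly f p).[l%:A] = f p.[l%:A].
Proof.
elim/poly_ind: p => [|p c ih]; first by rewrite map_lin0 !horner0 lin_0.
rewrite map_linD map_linMX map_linC !hornerAX ih.
by rewrite (lin_D fl) (lin_Z fl).
Qed.

End MapLinear.

End ScalarEvaluation.

Section ZeroTest.
Variables (K : numFieldType) (A : comAlgType K).

(* A polynomial over a [K]-module that vanishes at more scalars than its degree
   is zero; [A] need not be a domain, since differences of scalars are units. *)
Lemma poly_scalar_eq0 (p : {poly A}) : (forall l : K, p.[l%:A] = 0) -> p = 0.
Proof.
have main n (q : {poly A}) (s : seq K) : (size q <= n)%N -> uniq s ->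
    (n <= size s)%N -> (forall l, l \in s -> q.[l%:A] = 0) -> q = 0.
  elim: n q s => [|n ih] q s; first by rewrite size_poly_leq0 => /eqP.
  case: s => // l s qn /= /andP[ls us] ns qs.
  have /factor_theorem[r qr] : root q l%:A.
    by apply/eqP/qs; rewrite inE eqxx.
  suff r0 : r = 0 by rewrite qr r0 mul0r.
  apply: (ih _ s) => //.
    have [->|rn0] := eqVneq r 0; first by rewrite size_poly0.
    by move: qn; rewrite qr size_Mmonic ?monicXsubC // size_XsubC addn2.
  move=> m ms; have := qs m; rewrite inE ms orbT => /(_ isT).
  rewrite qr hornerM hornerXsubC -scalerBl mulrC mulr_algl.
  move=> /(congr1 (fun x => (m - l)^-1 *: x)).
  rewrite scalerA mulVf ?scale1r ?scaler0 // subr_eq0.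
  by apply: contraNneq ls => <-.
move=> h; apply: (main (size p) p [seq i%:R | i <- iota 0 (size p)]) => //.
- by rewrite map_inj_uniq ?iota_uniq // => i j /eqP; rewrite eqr_nat => /eqP.
- by rewrite size_map size_iota.
Qed.

Lemma poly_scalar_inj (p q : {poly A}) :
  (forall l : K, p.[l%:A] = q.[l%:A]) -> p = q.
Proof.
move=> h; apply/eqP; rewrite -subr_eq0; apply/eqP/poly_scalar_eq0 => l.
by rewrite !hornerE h subrr.
Qed.

End ZeroTest.

(** * The operator λ + d and the substitution of -λ - d *)

Section Skew.
Variables (K : fieldType) (A : comAlgType K) (d : A -> A).
Hypothesis dP : is_derivation d.
Implicit Types (p q : {poly A}) (l m : K).
Let dl : linear d := dP.1.
Let dM := dP.2.

(* Multiplication by [λ + d], where [λ] is the variable of [p]. *)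
Definition lshift p := p * 'X + map_poly d p.

(* The substitution of [- λ - d] for [λ], with [d] acting on coefficients. *)
Definition skewp p := foldr (fun c r => c%:P - lshift r) 0 (p : seq A).

Lemma lshift0 : lshift 0 = 0.
Proof. by rewrite /lshift mul0r map_lin0 ?addr0. Qed.

Lemma lshiftD : {morph lshift : p q / p + q}.
Proof. by move=> p q; rewrite /lshift mulrDl map_linD // addrACA. Qed.

Lemma lshiftN : {morph lshift : p / - p}.
Proof. by move=> p; rewrite /lshift mulNr map_linN // opprD. Qed.

Lemma lshiftMX p : lshift (p * 'X) = lshift p * 'X.
Proof. by rewrite /lshift map_linMX // mulrDl. Qed.

Lemma coef_lshift p n :
  (lshift p)`_n = (if n == 0%N then 0 else p`_n.-1) + d p`_n.
Proof. by rewrite coefD coefMX coef_map_lin. Qed.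

Lemma map_linMC p c :
  map_poly d (p * c%:P) = map_poly d p * c%:P + p * (d c)%:P.
Proof.
by apply/polyP => n; rewrite !(coefD, coef_map_lin, coefMC) // dM.
Qed.

Lemma lshiftMC p c : lshift (p * c%:P) = lshift p * c%:P + p * (d c)%:P.
Proof. by rewrite /lshift map_linMC mulrDl addrA mulrAC. Qed.

Lemma horner_lshift p l : (lshift p).[l%:A] = l *: p.[l%:A] + d p.[l%:A].
Proof.
by rewrite /lshift hornerD horner_map_lin // hornerMX mulrC mulr_algl.
Qed.

Lemma skew0 : skewp 0 = 0.
Proof. by rewrite /skewp polyseq0. Qed.

Lemma skewMXaddC p c : skewp (p * 'X + c%:P) = c%:P - lshift (skewp p).
Proof.
rewrite -cons_poly_def {1}/skewp polyseq_cons; case: nilP => [p0|//].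
have -> : p = 0 by apply/val_inj; rewrite /= p0 polyseq0.
rewrite skew0 lshift0 subr0 polyseqC; case: eqP => [->|_] //=.
by rewrite lshift0 subr0.
Qed.

Lemma skewC c : skewp c%:P = c%:P.
Proof.
rewrite -[c%:P]add0r -(mul0r 'X) skewMXaddC skew0 lshift0 subr0.
by rewrite mul0r add0r.
Qed.

Lemma skewMX p : skewp (p * 'X) = - lshift (skewp p).
Proof. by rewrite -[p * 'X]addr0 -polyC0 skewMXaddC polyC0 add0r. Qed.

Lemma skewD : {morph skewp : p q / p + q}.
Proof.
elim/poly_ind => [|p c ih] q; first by rewrite skew0 !add0r.
elim/poly_ind: q => [|q e _]; first by rewrite skew0 !addr0.
rewrite addrACA -mulrDl -polyCD !skewMXaddC ih lshiftD polyCD.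
by rewrite opprD addrACA.
Qed.

Lemma skewN : {morph skewp : p / - p}.
Proof. by move=> p; apply/eqP; rewrite -addr_eq0 -skewD addNr skew0. Qed.

Lemma skewB : {morph skewp : p q / p - q}.
Proof. by move=> p q; rewrite skewD skewN. Qed.

Lemma map_lshift p : map_poly d (lshift p) = lshift (map_poly d p).
Proof. by rewrite /lshift map_linD // map_linMX. Qed.

Lemma skew_map p : skewp (map_poly d p) = map_poly d (skewp p).
Proof.
elim/poly_ind: p => [|p c ih]; first by rewrite map_lin0 // skew0 map_lin0.
rewrite map_linD // map_linMX // map_linC // !skewMXaddC ih.
by rewrite map_linD // map_linN // map_linC // map_lshift.
Qed.

(** Substituting -λ - d for λ turns λ + d into (-λ - d) + d = -λ. *)
Lemma skew_lshift p : skewp (lshift p) = - (skewp p * 'X).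
Proof.
by rewrite {1}/lshift skewD skewMX skew_map /lshift opprD -addrA addNr addr0.
Qed.

Lemma skewK p : skewp (skewp p) = p.
Proof.
elim/poly_ind: p => [|p c ih]; first by rewrite !skew0.
by rewrite skewMXaddC skewB skewC skew_lshift ih opprK addrC.
Qed.

(* [skew_mul p c] is the series [p(λ + d) c] with [d] acting on [c] only: the
   left Leibniz rule then follows from the right one and skew-symmetry. *)
Definition skew_mul p c := skewp (skewp p * c%:P).

Lemma skew_mulD p q c : skew_mul (p + q) c = skew_mul p c + skew_mul q c.
Proof. by rewrite /skew_mul skewD mulrDl skewD. Qed.

(** Each factor λ of p becomes λ + d with d falling on c only: this recursion identifies
    [skew_mul p c] with p(λ + d)c. *)
Lemma skew_mulMX p c :
  skew_mul (p * 'X) c = skew_mul p c * 'X + skew_mul p (d c).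
Proof.
rewrite /skew_mul skewMX mulNr.
have -> : lshift (skewp p) * c%:P =
    lshift (skewp p * c%:P) - skewp p * (d c)%:P.
  by rewrite lshiftMC addrK.
by rewrite opprB skewB skew_lshift opprK addrC.
Qed.

Lemma skew_mulC a c : skew_mul a%:P c = (a * c)%:P.
Proof. by rewrite /skew_mul skewC -polyCM skewC. Qed.

(** Since d never falls on the coefficients of p, a factor a of them passes through. The induction
    varies c, which the recursion replaces by d c. *)
Lemma skew_mul_linear p a c : skew_mul (p * a%:P) c = skew_mul p c * a%:P.
Proof.
elim/poly_ind: p c => [|p b ih] c.
  by rewrite mul0r /skew_mul !(skew0, mul0r).
rewrite mulrDl mulrAC -polyCM !skew_mulD !skew_mulMX !skew_mulC !ih.
rewrite !mulrDl -polyCM [b * a * c]mulrAC.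
by congr (_ + _ + _); rewrite mulrAC.
Qed.

Lemma skew_mul_lshift p c : skew_mul (lshift p) c = lshift (skew_mul p c).
Proof. by rewrite /skew_mul skew_lshift mulNr mulrAC skewN skewMX opprK. Qed.

End Skew.

Lemma sum_ord_eq (V : nmodType) (F : nat -> V) M N :
  (M <= N)%N -> (forall i, (M <= i)%N -> F i = 0) ->
  \sum_(i < M) F i = \sum_(i < N) F i.
Proof.
move=> MN F0; rewrite -(subnKC MN) big_split_ord /= [X in _ + X]big1 ?addr0 //.
by move=> i _; rewrite F0 ?leq_addr.
Qed.

(** * Lambda-brackets on a differential algebra *)

Section LambdaBracket.
Variables (K : numFieldType) (A : comAlgType K) (d : A -> A).
Hypothesis dP : is_derivation d.
Implicit Types (p q : {poly A}) (l m : K).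

(** Brings scalar actions into a form that [ring] can treat. *)
Lemma alg_scale x (a : A) : x *: a = in_alg A x * a.
Proof. by rewrite in_algE mulr_algl. Qed.

Lemma skewZ (x : K) p : skewp d (x%:A *: p) = x%:A *: skewp d p.
Proof.
have dl : linear d := dP.1.
elim/poly_ind: p => [|p c ih]; first by rewrite scaler0 skew0 // scaler0.
rewrite scalerDr -!mul_polyC mulrA -polyCM mul_polyC !skewMXaddC // ih mulrBr.
rewrite -polyCM; congr (_ - _); rewrite /lshift mulrDr mul_polyC scalerAl.
congr (_ + _); apply/polyP => n.
by rewrite coefCM !(coef_map_lin, coefZ) // !mulr_algl (lin_Z dl).
Qed.

(** The properties of {a_λ b} as a function of b. As [{poly A}] is a module over A, a scalar x acts
    on it as [x%:A]. *)
Definition lambda_derivation (T : A -> {poly A}) : Prop :=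
  [/\ forall x a b, T (x *: a + b) = x%:A *: T a + T b,
      forall a b, T (a * b) = T a * b%:P + T b * a%:P &
      forall a, T (d a) = lshift d (T a)].

(* [Br a b] stands for [{a_λ b} = \sum_n λ^n a_n b / n!]. *)
Definition lambda_bracket (Br : A -> A -> {poly A}) : Prop :=
  (forall a, lambda_derivation (Br a)) /\
  (forall a b, Br b a = - skewp d (Br a b)).

Lemma lambda_derivation_linear (T : A -> {poly A}) : lambda_derivation T ->
  [/\ T 0 = 0, forall a b, T (a + b) = T a + T b &
      forall x a, T (x *: a) = x%:A *: T a].
Proof.
move=> [Tl _ _].
have T0 : T 0 = 0.
  move: (Tl 1 0 0); rewrite scaler0 addr0 !scale1r => /eqP.
  by rewrite -subr_eq subrr eq_sym => /eqP.
split=> // [a b|x a]; last by rewrite -[x *: a]addr0 Tl T0 addr0.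
by rewrite -[a in LHS]scale1r Tl !scale1r.
Qed.

Lemma lambda_derivation_const (T : A -> {poly A}) x :
  lambda_derivation T -> T x%:A = 0.
Proof.
move=> TP; have [_ _ ->] := lambda_derivation_linear TP.
have [_ TM _] := TP; have /eqP := TM 1 1.
by rewrite !mulr1 -subr_eq subrr eq_sym => /eqP ->; rewrite scaler0.
Qed.

(** Generation of A as a differential algebra, phrased as an induction principle. *)
Definition diff_generated (U : Type) (iota : U -> A) : Prop :=
  forall P : A -> Prop, (forall u, P (iota u)) -> (forall x : K, P x%:A) ->
  (forall a b, P a -> P b -> P (a + b)) ->
  (forall a b, P a -> P b -> P (a * b)) ->
  (forall a, P a -> P (d a)) -> forall a, P a.

Section Generated.
Variables (U : Type) (iota : U -> A).
Hypothesis gen : diff_generated iota.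

Lemma lambda_derivation_uniq (T T' : A -> {poly A}) :
  lambda_derivation T -> lambda_derivation T' ->
  (forall u, T (iota u) = T' (iota u)) -> forall a, T a = T' a.
Proof.
move=> TP TP' e; have [_ TM Td] := TP; have [_ TM' Td'] := TP'.
have [_ TD _] := lambda_derivation_linear TP.
have [_ TD' _] := lambda_derivation_linear TP'.
apply: gen => // [x|a b ha hb|a b ha hb|a ha].
- by rewrite !lambda_derivation_const.
- by rewrite TD TD' ha hb.
- by rewrite TM TM' ha hb.
- by rewrite Td Td' ha.
Qed.

(* As functions of [a], [{(b c)_λ a}] and the expression that the left Leibniz
   rule gives for it are lambda-derivations, hence determined by their values at
   generators; there skew-symmetry reduces left to right Leibniz. *)
Lemma lambda_bracket_gen (Br : A -> A -> {poly A}) :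
  (forall a, lambda_derivation (Br a)) ->
  (forall a u, Br a (iota u) = - skewp d (Br (iota u) a)) ->
  lambda_bracket Br.
Proof.
move=> BrD Bsk; split=> // a b; move: b a.
have Blin b := lambda_derivation_linear (BrD b).
have BC (x : K) a : Br x%:A a = 0.
  have z : lambda_derivation (fun=> 0 : {poly A}).
    by split=> *; rewrite ?scaler0 ?mul0r ?addr0 // lshift0.
  apply: (lambda_derivation_uniq (BrD _) z) => u.
  by rewrite Bsk lambda_derivation_const // skew0 oppr0.
have BD b c a : Br (b + c) a = Br b a + Br c a.
  have z : lambda_derivation (fun a => Br b a + Br c a).
    have [Dl Dm Dd] := BrD b; have [El Em Ed] := BrD c.
    split=> [x y w|x y|x].
    - by rewrite Dl El scalerDr addrACA.
    - by rewrite Dm Em !mulrDl addrACA.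
    - by rewrite Dd Ed lshiftD.
  apply: (lambda_derivation_uniq (BrD _) z) => u.
  by have [_ D _] := Blin (iota u); rewrite !Bsk D skewD // opprD.
have BM b c a : Br (b * c) a = skew_mul d (Br b a) c + skew_mul d (Br c a) b.
  have z : lambda_derivation
      (fun a => skew_mul d (Br b a) c + skew_mul d (Br c a) b).
    have [Dl Dm Dd] := BrD b; have [El Em Ed] := BrD c.
    split=> [x y w|x y|x].
    - rewrite Dl El -!mul_polyC !skew_mulD // ![_%:P * _]mulrC.
      by rewrite !skew_mul_linear // mulrDl addrACA.
    - rewrite Dm Em !skew_mulD // !skew_mul_linear //.
      by rewrite !mulrDl addrACA.
    - by rewrite Dd Ed lshiftD // !skew_mul_lshift.
  apply: (lambda_derivation_uniq (BrD _) z) => u.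
  have [_ M _] := BrD (iota u); rewrite !Bsk M skewD // opprD.
  by rewrite /skew_mul !skewN // !skewK // !mulNr !skewN.
have Bd b a : Br (d b) a = - (Br b a * 'X).
  have z : lambda_derivation (fun a => - (Br b a * 'X)).
    have [Dl Dm Dd] := BrD b.
    split=> [x y w|x y|x].
    - by rewrite Dl mulrDl opprD scalerN scalerAl.
    - by rewrite Dm mulrDl opprD !mulNr mulrAC [_ * x%:P * _]mulrAC.
    - by rewrite Dd lshiftN // lshiftMX.
  apply: (lambda_derivation_uniq (BrD _) z) => u.
  have [_ _ D] := BrD (iota u).
  by rewrite !Bsk D skew_lshift // mulNr.
(* Both sides now obey the same rules as functions of b, so skew-symmetry passes from generators to
   all of A. *)
elim/gen => [u|x|b c hb hc|b c hb hc|b hb] a.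
- by rewrite Bsk skewN // skewK // opprK.
- by rewrite BC lambda_derivation_const // skew0 oppr0.
- by have [_ D _] := Blin a; rewrite BD hb hc D skewD // opprD.
- have [_ M _] := BrD a; rewrite BM hb hc M skewD // opprD.
  by rewrite /skew_mul !skewN // !skewK // !mulNr !skewN.
- have [_ _ D] := BrD a.
  by rewrite Bd hb D skew_lshift // mulNr.
Qed.

End Generated.

(** * The Jacobi identity and its symmetries *)

Section Jacobi.
Variable Br : A -> A -> {poly A}.
Hypothesis BrP : lambda_bracket Br.

Definition brev l a b : A := (Br a b).[l%:A].

(** Skew-symmetry moves d a to the second argument, where it produces λ + d; the substitution turns
    this into -λ. *)
Lemma lambda_sesqui a b : Br (d a) b = - (Br a b * 'X).
Proof.
have [Bd Bs] := BrP; have [_ _ Bda] := Bd b.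
by rewrite [LHS]Bs Bda skew_lshift // opprK [Br a b]Bs mulNr opprK.
Qed.

Lemma lambda_linl b x a a' : Br (x *: a + a') b = x%:A *: Br a b + Br a' b.
Proof.
have [Bd Bs] := BrP; have [Bl _ _] := Bd b.
rewrite Bs Bl skewD // skewZ opprD -scalerN.
by rewrite -!Bs.
Qed.

Lemma brev_linr l a : linear (brev l a).
Proof.
move=> x b c; have [[Bl _ _] _] := (BrP.1 a, tt).
by rewrite /brev Bl hornerD hornerZ mulr_algl.
Qed.

Lemma brev_linl l b : linear (fun a => brev l a b).
Proof.
by move=> x a c; rewrite /brev lambda_linl hornerD hornerZ mulr_algl.
Qed.

Lemma brevM l a b c : brev l a (b * c) = brev l a b * c + b * brev l a c.
Proof.
have [_ BM _] := BrP.1 a.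
by rewrite /brev BM hornerD !hornerM !hornerC [b * _]mulrC.
Qed.

Lemma brev_dr l a b : brev l a (d b) = l *: brev l a b + d (brev l a b).
Proof. by have [_ _ Bda] := BrP.1 a; rewrite /brev Bda horner_lshift. Qed.

Lemma brev_dl l a b : brev l (d a) b = - (l *: brev l a b).
Proof. by rewrite /brev lambda_sesqui hornerN hornerMX mulrC mulr_algl. Qed.

Lemma brev_const l a x : brev l a x%:A = 0.
Proof.
have b1 : brev l a 1 = 0.
  have := brevM l a 1 1; rewrite !mulr1 mul1r => /eqP.
  by rewrite -subr_eq subrr eq_sym => /eqP.
by rewrite (lin_Z (brev_linr l a)) b1 scaler0.
Qed.

(* The two formal variables of the Jacobi identity range over scalars, which
   loses nothing since [K] is infinite. *)
Definition jacobi a b c : Prop := forall l m,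
  brev l a (brev m b c) = brev m b (brev l a c) + brev (l + m) (brev l a b) c.

Lemma jacobi_lin a b x c c' :
  jacobi a b c -> jacobi a b c' -> jacobi a b (x *: c + c').
Proof.
move=> h h' l m; rewrite !brev_linr h h'.
by rewrite scalerDr addrACA.
Qed.

Lemma jacobi_const a b x : jacobi a b x%:A.
Proof.
move=> l m; rewrite !brev_const (lin_0 (brev_linr l a)).
by rewrite (lin_0 (brev_linr m b)) addr0.
Qed.

(** Mixed products such as {a_l c}{b_m c'} occur equally on both sides. *)
Lemma jacobi_mul a b c c' :
  jacobi a b c -> jacobi a b c' -> jacobi a b (c * c').
Proof.
move=> h h' l m.
rewrite !brevM !(lin_D (brev_linr _ _)) !brevM h h'.
ring.
Qed.

(** Replacing c by d c applies l + m + d to each of the three terms. *)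
Lemma jacobi_der a b c : jacobi a b c -> jacobi a b (d c).
Proof.
move=> h l m; rewrite !brev_dr.
rewrite !(lin_D (brev_linr _ _)) !(lin_Z (brev_linr _ _)) !brev_dr h.
rewrite (lin_D dP.1) !alg_scale rmorphD /=.
ring.
Qed.

Lemma jacobi_swap12 a b c : jacobi a b c -> jacobi b a c.
Proof.
(* In the first argument of a bracket at l + m, d acts as -(l + m), so -m - d acts there as l. *)
have key l m p :
    brev (l + m) (skewp d p).[m%:A] c = brev (l + m) p.[l%:A] c.
  have bl := brev_linl (l + m) c.
  elim/poly_ind: p => [|p x ih]; first by rewrite skew0 !horner0.
  rewrite skewMXaddC // hornerAX hornerD hornerN hornerC horner_lshift //.
  rewrite (lin_B bl) (lin_D bl) (lin_Z bl) brev_dl ih (lin_D bl) (lin_Z bl).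
  rewrite !alg_scale rmorphD /=.
  ring.
move=> h l m; rewrite (h m l).
have -> : brev (l + m) (brev l b a) c = - brev (m + l) (brev m a b) c.
  rewrite [m + l]addrC {2}/brev BrP.2 hornerN (lin_N (brev_linl _ _)).
  by rewrite [l + m]addrC key.
by rewrite addrK.
Qed.

Lemma jacobi_swap23 a b c : jacobi a c b -> jacobi a b c.
Proof.
(* Moving {a_l -} past d turns d into l + d, hence -m - d into -(l + m) - d. *)
have keyA l m p : brev l a (skewp d p).[m%:A] =
    (skewp d (map_poly (brev l a) p)).[(l + m)%:A].
  have bl := brev_linr l a.
  elim/poly_ind: p => [|p x ih].
    by rewrite (map_lin0 bl) skew0 !horner0 (lin_0 bl).
  rewrite (map_linD bl) (map_linMX bl) (map_linC bl) !skewMXaddC //.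
  rewrite !hornerD !hornerN !hornerC !horner_lshift // (lin_B bl) (lin_D bl).
  by rewrite (lin_Z bl) brev_dr ih addrA -scalerDl [m + l]addrC.
(* The shift by l compensates: -(l + m) - d + l = -m - d. *)
have keyB l m p : (skewp d (p \Po ('X + (l%:A)%:P))).[(l + m)%:A] =
    (skewp d p).[m%:A].
  elim/poly_ind: p => [|p x ih]; first by rewrite comp_poly0 skew0 !horner0.
  rewrite comp_poly_MXaddC mulrDr -addrA skewD // skewMX // skewD //.
  rewrite skewMXaddC // mulrC mul_polyC skewZ skewC //.
  rewrite !hornerD !hornerN !hornerC !horner_lshift // hornerZ ih.
  rewrite mulr_algl !alg_scale rmorphD /=.
  ring.
move=> h l m.
(* The hypothesis at all scalars x becomes an identity of polynomials, into which -λ - d can then be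
   substituted. *)
have P : map_poly (brev l a) (Br c b) = Br c (brev l a b) +
    (Br (brev l a c) b \Po ('X + (l%:A)%:P)).
  apply: poly_scalar_inj => x.
  rewrite horner_map_lin; last exact: brev_linr.
  rewrite hornerD horner_comp !hornerE -scalerDl [x + l]addrC.
  exact: h.
rewrite {2}/brev (BrP.2 c b) hornerN (lin_N (brev_linr _ _)) keyA P.
rewrite skewD // hornerD keyB opprD addrC -!hornerN -!BrP.2.
by [].
Qed.

Lemma jacobi_span (J : eqType) a b (s : seq J) (x : J -> K) (F : J -> A) :
  (forall j, jacobi a b (F j)) -> jacobi a b (\sum_(j <- s) x j *: F j).
Proof.
move=> h; elim: s => [|j s ih].
  by rewrite big_nil -(scale0r 1); exact: jacobi_const.
by rewrite big_cons; apply: jacobi_lin.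
Qed.


(** Taylor expansion at x in divided derivatives. *)
Lemma coef_comp_XaddC (p : {poly A}) (x : A) n :
  (p \Po ('X + x%:P))`_n = p^`N(n).[x].
Proof.
elim/poly_ind: p n => [|p c ih] n.
  by rewrite comp_poly0 coef0 linear0 horner0.
rewrite comp_poly_MXaddC mulrDr coefD coefD coefMX coefMC.
case: n => [|n] /=.
  by rewrite ih !nderivn0 coefC eqxx hornerMXaddC add0r.
by rewrite !ih coefC /= addr0 nderivnMXaddC hornerD hornerMX.
Qed.

Lemma jacobi_coefP a b c : jacobi a b c <-> forall m n : nat,
  (Br a (Br b c)`_n)`_m - (Br b (Br a c)`_m)`_n =
  \sum_(i < m.+1) (Br (Br a b)`_i c)`_(m + n - i) *+ 'C(m + n - i, n).
Proof.
pose cf n x := (Br b x)`_n.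
have cl n : linear (cf n).
  move=> x y z; have [Bl _ _] := BrP.1 b.
  by rewrite /cf Bl coefD coefZ mulr_algl.
pose third n := \sum_(i < size (Br a b)) (Br (Br a b)`_i c)^`N(n) * 'X^i.
pose Q n := Br a (Br b c)`_n - map_poly (cf n) (Br a c) - third n.
have thirdE n l : (third n).[l%:A] = (Br (brev l a b) c)^`N(n).[l%:A].
  pose g y := (Br y c)^`N(n).[l%:A].
  have gl : linear g.
    move=> x y z; rewrite /g lambda_linl nderivnD nderivnZ.
    by rewrite hornerD hornerZ mulr_algl.
  rewrite -/(g (brev l a b)) /brev [in RHS]horner_coef (lin_sum gl) horner_sum.
  apply: eq_bigr => i _.
  rewrite hornerM hornerXn -[l%:A]/(in_alg A l) -rmorphXn /= !mulr_algr.
  by rewrite (lin_Z gl).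
have QE n l : (Q n).[l%:A] = (map_poly (brev l a) (Br b c) - Br b (brev l a c)
    - (Br (brev l a b) c \Po ('X + (l%:A)%:P)))`_n.
  rewrite !hornerD !hornerN thirdE (horner_map_lin (cl n)) !coefB.
  by rewrite (coef_map_lin (brev_linr l a)) coef_comp_XaddC.
have coefQ n (m : nat) : (Q n)`_m =
    (Br a (Br b c)`_n)`_m - (Br b (Br a c)`_m)`_n -
    \sum_(i < m.+1) (Br (Br a b)`_i c)`_(m + n - i) *+ 'C(m + n - i, n).
  rewrite !coefB (coef_map_lin (cl n)); congr (_ - _ - _).
  have Br0 y : Br 0 y = 0.
    have := lambda_linl y (-1) 0 0.
    by rewrite scaler0 addr0 scaleNr scale1r scaleN1r addNr.
  (* The value 0 beyond m lets the sum over the coefficients of [Br a b] and the sum over i <= m be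
     extended to a common range. *)
  pose F i := if (m < i)%N then 0 else
    (Br (Br a b)`_i c)`_(n + (m - i)) *+ 'C(n + (m - i), n).
  have -> : (third n)`_m = \sum_(i < size (Br a b)) F i.
    rewrite coef_sum; apply: eq_bigr => i _.
    by rewrite coefMXn coef_nderivn.
  have <- : \sum_(i < m.+1) F i =
      \sum_(i < m.+1) (Br (Br a b)`_i c)`_(m + n - i) *+ 'C(m + n - i, n).
    apply: eq_bigr => i _; have im : (i <= m)%N by rewrite -ltnS.
    by rewrite /F ltnNge im /= addnBA // [(n + m)%N]addnC.
  rewrite (sum_ord_eq (N := maxn (size (Br a b)) m.+1)) ?leq_maxl //.
    rewrite [RHS](sum_ord_eq (N := maxn (size (Br a b)) m.+1)) ?leq_maxr //.
    by move=> i mi; rewrite /F mi.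
  move=> i si; rewrite /F; case: ifP => // _.
  by rewrite [(Br a b)`_i]nth_default // Br0 coef0 mul0rn.
have jQ : jacobi a b c <-> forall n, Q n = 0.
  split=> [h n|h l m].
    apply: poly_scalar_eq0 => l; rewrite QE.
    suff -> : map_poly (brev l a) (Br b c) - Br b (brev l a c)
      - (Br (brev l a b) c \Po ('X + (l%:A)%:P)) = 0 by rewrite coef0.
    apply: poly_scalar_eq0 => m.
    rewrite !hornerE (horner_map_lin (brev_linr l a)) horner_comp !hornerE.
    rewrite -scalerDl [m + l]addrC -/(brev m b c) h addrAC addrK.
    by rewrite subrr.
  suff /(congr1 (fun p => p.[m%:A])) :
      map_poly (brev l a) (Br b c) - Br b (brev l a c) -
      (Br (brev l a b) c \Po ('X + (l%:A)%:P)) = 0.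
    rewrite !hornerE (horner_map_lin (brev_linr l a)) horner_comp !hornerE.
    rewrite -scalerDl [m + l]addrC -/(brev m b c) => /eqP.
    by rewrite -addrA -opprD subr_eq0 => /eqP.
  by apply/polyP => n; rewrite -QE h horner0 coef0.
split.
  move/jQ => h m n; apply/eqP; rewrite -subr_eq0 -coefQ h coef0 //.
move=> h; apply/jQ => n; apply/polyP => m.
by rewrite coefQ h subrr coef0.
Qed.

End Jacobi.
End LambdaBracket.

Lemma fsbig_nat_ord (V : nmodType) (F : nat -> V) N :
  (forall i, (N <= i)%N -> F i = 0) ->
  \sum_(i \in [set: nat]) F i = \sum_(i < N) F i.
Proof.
move=> F0; rewrite fsbig_ord; apply/esym/fsbig_widen => // i [_ /= /negP].
by rewrite -leqNgt => /F0.
Qed.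

(** * Modes of a polynomial; the axioms (C2) and (C3) *)

Section Modes.
Variables (K : numFieldType) (A : comAlgType K) (d : A -> A).
Hypothesis dP : is_derivation d.
Implicit Types p q : {poly A}.
Let dl : linear d := dP.1.

Lemma fact_unit n : n`!%:R != 0 :> K.
Proof. by rewrite pnatr_eq0 -lt0n fact_gt0. Qed.

Definition modes p n : A := n`!%:R *: p`_n.

Lemma modes_inj p q : (forall n, modes p n = modes q n) -> p = q.
Proof.
by move=> h; apply/polyP => n; apply: (scalerI (fact_unit n)); exact: h.
Qed.

Lemma modesD p q n : modes (p + q) n = modes p n + modes q n.
Proof. by rewrite /modes coefD scalerDr. Qed.

Lemma modesZ (x : K) p n : modes (x%:A *: p) n = x *: modes p n.
Proof. by rewrite /modes coefZ mulr_algl !scalerA mulrC. Qed.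

Lemma modesMC p a n : modes (p * a%:P) n = modes p n * a.
Proof. by rewrite /modes coefMC scalerAl. Qed.

Lemma modes_lshift p n :
  modes (lshift d p) n = d (modes p n) + n%:R *: modes p n.-1.
Proof.
rewrite /modes coef_lshift // scalerDr (lin_Z dl) addrC; congr (_ + _).
case: n => [|n] /=; first by rewrite scaler0 scale0r.
by rewrite scalerA factS natrM.
Qed.

Lemma modes_nil p n : (size p <= n)%N -> modes p n = 0.
Proof. by move=> pn; rewrite /modes nth_default // scaler0. Qed.

Lemma modes_exists (h : nat -> A) N : (forall n, (N <= n)%N -> h n = 0) ->
  exists p, forall n, modes p n = h n.
Proof.
move=> hN; exists (\poly_(n < N) ((n`!%:R : K)^-1 *: h n)) => n.
rewrite /modes coef_poly; case: ltnP => [_|/hN ->]; last by rewrite scaler0.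
by rewrite scalerA mulfV ?fact_unit // scale1r.
Qed.

(** Binomial expansion of (-λ - d)^(n+i), where multiplication by λ commutes with d. *)
Lemma coef_skew p n N : (size p <= N)%N ->
  (skewp d p)`_n = \sum_(i < N) ((-1) ^+ (n + i) * 'C(n + i, n)%:R : K) *:
    iter i d p`_(n + i).
Proof.
have it0 i : iter i d 0 = 0 by apply/lin_0/lin_iter.
elim/poly_ind: p n N => [|p c ih] n N sN.
  by rewrite skew0 coef0 big1 // => i _; rewrite coef0 it0 scaler0.
case: N sN => [|N] sN.
  move: sN; rewrite size_poly_leq0 => /eqP ->.
  by rewrite skew0 coef0 big_ord0.
have {}sN : (size p <= N)%N.
  move: sN; rewrite size_MXaddC; case: ifP => // /andP[/eqP -> _] _.
  by rewrite size_poly0.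
rewrite skewMXaddC // coefB coef_lshift // coefC.
have itd i x : iter i.+1 d x = d (iter i d x) by [].
have dsum n' : d (skewp d p)`_n' = \sum_(i < N)
    ((-1) ^+ (n' + i) * 'C(n' + i, n')%:R : K) *: iter i.+1 d p`_(n' + i).
  rewrite (ih _ N) // (lin_sum dl); apply: eq_bigr => i _.
  by rewrite (lin_Z dl).
case: n => [|n] /=.
  rewrite big_ord_recl /= add0n expr0 bin0 mul1r scale1r coefD coefMX coefC.
  rewrite !eqxx !add0r dsum; congr (_ + _).
  rewrite -sumrN; apply: eq_bigr => i _.
  rewrite /bump /= !add0n !add1n !bin0 !mulr1.
  by rewrite coefD coefMX coefC /= addr0 exprS mulN1r scaleNr.
(* Pascal's rule separates the contributions of -λ and of -d in the new factor -λ - d. *)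
have -> : \sum_(i < N.+1) ((-1) ^+ (n.+1 + i) * 'C(n.+1 + i, n.+1)%:R : K) *:
      iter i d (p * 'X + c%:P)`_(n.+1 + i) =
    \sum_(i < N.+1) ((-1) ^+ (n.+1 + i) * 'C(n + i, n)%:R : K) *:
      iter i d p`_(n + i) +
    \sum_(i < N.+1) ((-1) ^+ (n.+1 + i) * 'C(n + i, n.+1)%:R : K) *:
      iter i d p`_(n + i).
  rewrite -big_split; apply: eq_bigr => i _ /=.
  rewrite coefD coefMX coefC !addSn /= addr0 -scalerDl -mulrDr -natrD.
  by rewrite binS [('C(_, n.+1) + _)%N]addnC.
rewrite sub0r opprD; congr (_ + _).
  rewrite (ih n N.+1) ?leqW // -sumrN; apply: eq_bigr => i _.
  by rewrite -scaleNr -mulNr addSn exprS mulN1r.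
rewrite big_ord_recl /= bin_small ?addn0 // mulr0 scale0r add0r dsum -sumrN.
apply: eq_bigr => i _; rewrite /bump /= add1n -scaleNr -mulNr !addSn !addnS.
by rewrite !exprS !mulN1r opprK.
Qed.

(** This is the right side of (C2), because n! C(n+i, n) = (n+i)! / i!. *)
Lemma modes_skew p n : modes (- skewp d p) n =
  \sum_(i \in [set: nat]) ((-1) ^+ (n + i + 1) * (i`!%:R : K)^-1) *:
    iter i d (modes p (n + i)).
Proof.
have it i : linear (iter i d) by exact: lin_iter.
rewrite (fsbig_nat_ord (N := size p)) => [|i pi]; last first.
  by rewrite modes_nil ?(lin_0 (it i)) ?scaler0 // (leq_trans pi) // leq_addl.
rewrite /modes coefN (coef_skew _ (leqnn _)) scalerN scaler_sumr -sumrN.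
apply: eq_bigr => i _; rewrite (lin_Z (it i)) !scalerA -scaleNr.
congr (_ *: _); rewrite -(bin_fact (leq_addr i n)) addKn !natrM addn1 exprS.
by field; rewrite fact_unit.
Qed.

(** (C3) is the coefficient form of the Jacobi identity multiplied by m! n!, since m! n! C(m+n-i, n)
    = C(m, i) i! (m+n-i)!. *)
Lemma jacobi_modesP (Br : A -> A -> {poly A}) : lambda_bracket d Br ->
  forall a b c, jacobi Br a b c <-> forall m n : nat,
    modes (Br a (modes (Br b c) n)) m - modes (Br b (modes (Br a c) m)) n =
    \sum_(i < m.+1) 'C(m, i)%:R *: modes (Br (modes (Br a b) i) c) (m + n - i).
Proof.
move=> BrP a b c.
have Zr x y z n : (Br x (y *: z))`_n = y *: (Br x z)`_n.
  have [/(_ y z 0) Bl _ _] := BrP.1 x; have [/(_ (-1) 0 0) B0 _ _] := BrP.1 x.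
  move: B0 Bl; rewrite scaler0 !addr0 scaleNr scale1r scaleN1r addNr => ->.
  by rewrite addr0 => ->; rewrite coefZ mulr_algl.
have Zl x y z n : (Br (y *: x) z)`_n = y *: (Br x z)`_n.
  have B0 := lambda_linl dP BrP z (-1) 0 0.
  move: B0; rewrite scaler0 addr0 scaleNr scale1r scaleN1r addNr => B0.
  by rewrite -[y *: x]addr0 (lambda_linl dP BrP) B0 addr0 coefZ mulr_algl.
have LE m n : modes (Br a (modes (Br b c) n)) m -
    modes (Br b (modes (Br a c) m)) n = (m`!%:R * n`!%:R) *:
    ((Br a (Br b c)`_n)`_m - (Br b (Br a c)`_m)`_n).
  by rewrite /modes !Zr !scalerA scalerBr [n`!%:R * _]mulrC.
have RE m n : \sum_(i < m.+1) 'C(m, i)%:R *: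
      modes (Br (modes (Br a b) i) c) (m + n - i) = (m`!%:R * n`!%:R) *:
    \sum_(i < m.+1) (Br (Br a b)`_i c)`_(m + n - i) *+ 'C(m + n - i, n).
  rewrite scaler_sumr; apply: eq_bigr => i _.
  have im : (i <= m)%N by rewrite -ltnS.
  rewrite /modes Zl !scalerA -scaler_nat scalerA -!natrM; congr (_%:R *: _).
  rewrite -(bin_fact im) -(bin_fact (_ : n <= m + n - i)%N); last first.
    by rewrite -addnBAC // leq_addl.
  have -> : (m + n - i - n = m - i)%N by rewrite -addnBAC // addnK.
  ring.
rewrite (jacobi_coefP dP BrP); split=> h m n; first by rewrite LE RE h.
apply: (scalerI (_ : m`!%:R * n`!%:R != 0 :> K)); last by rewrite -LE -RE h.
by rewrite mulf_neq0 ?fact_unit.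
Qed.

End Modes.

(** * Induction on the free differential algebra *)

Section FreeDiffAlgInduction.
Variables (K : numFieldType) (U : lmodType K).
Notation A := (fdalg U).
Notation der := (@fd_der K U).
Let derP : is_derivation der := fd_der_derivation U.
Let der_lin : linear der := derP.1.

Lemma fd_ind_iter (P : A -> Prop) :
  (forall n u, P (iter n der (fd_in u))) -> (forall x : K, P x%:A) ->
  (forall a b, P a -> P b -> P (a + b)) ->
  (forall a b, P a -> P b -> P (a * b)) -> forall a, P a.
Proof.
move=> Pin Pc PD PM; elim/sym_ind; elim=> [f|x|x ihx y ihy|x ihx y ihy].
- have [N hN] : exists N, forall n, (N <= n)%N -> f n = 0.
    exact/asboolP/(valP f).
  (* Induction on a bound of the support, for every d^k f at once: f is its constant term plus d
     applied to a shorter tail. *)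
  rewrite -/(sym_in f) -[sym_in f]/(iter 0 der (sym_in f)).
  elim: N f 0%N hN => [|N ih] f k hN.
    have -> : f = 0 by apply: dmodP => n; rewrite hN.
    rewrite linear0 (lin_0 (lin_iter k der_lin)) -(scale0r 1); exact: Pc.
  have tail_proof : (fun n => f n.+1) \in @finsupp K U.
    by apply/asboolP; exists N => n Nn; rewrite hN.
  have -> : f = dmono0 (f 0%N) + dshift (Dmod tail_proof).
    by apply: dmodP => -[|n] /=; rewrite fctE /= ?addr0 ?add0r.
  rewrite linearD (lin_D (lin_iter k der_lin)); apply: PD; first exact: Pin.
  have -> g : iter k der (sym_in (dshift g)) = iter k.+1 der (sym_in g).
    by rewrite iterSr fd_der_in.
  by apply: ih => n Nn; exact: hN.
- by rewrite sym_piCE; exact: Pc.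
- by rewrite sym_piDE; exact: PD.
- by rewrite sym_piME; exact: PM.
Qed.

Lemma fd_ind : diff_generated der (@fd_in K U).
Proof.
move=> P Pin Pc PD PM Pd; apply: fd_ind_iter => // n u.
by elim: n => [|n ih] /=; [exact: Pin|exact: Pd].
Qed.

End FreeDiffAlgInduction.

(** * Formal exponentials of an operator *)

Section ExponentialSeries.
Variables (K : numFieldType) (V : lmodType K) (d : V -> V).
Hypothesis dl : linear d.

Lemma pexp0 (h : nat -> V) : pexp d h 0 = h 0%N.
Proof. by rewrite /pexp big_ord1 /= invr1 scale1r. Qed.

(* The differential equation of [x1 |-> e^(x1 d) h(x1)]. *)
Lemma pexp_succ (h : nat -> V) n : (n.+1%:R : K) *: pexp d h n.+1 =
  d (pexp d h n) + pexp d (fun j => (j.+1%:R : K) *: h j.+1) n.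
Proof.
rewrite /pexp (lin_sum dl) scaler_sumr.
have it i : linear (iter i d) by exact: lin_iter.
under eq_bigr => i _.
  have -> : (n.+1)%:R = i%:R + (n.+1 - i)%:R :> K.
    by rewrite -natrD subnKC // -ltnS.
  rewrite scalerDl.
  over.
rewrite big_split /=; congr (_ + _).
  rewrite big_ord_recl scale0r add0r; apply: eq_bigr => i _.
  rewrite (lin_Z dl) /= /bump /= add1n subSS scalerA; congr (_ *: _).
  by rewrite factS natrM invfM mulrA mulfV ?mul1r // pnatr_eq0.
rewrite big_ord_recr /= subnn scale0r addr0; apply: eq_bigr => i _.
have im : (i <= n)%N by rewrite -ltnS.
by rewrite subSn // (lin_Z (it i)) !scalerA mulrC.
Qed.

Lemma pexp_const (v : V) n : (n`!%:R : K) *: pexp d (pconst v) n = iter n d v.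
Proof.
have d0 k : iter k d 0 = 0 by exact/lin_0/lin_iter.
elim: n => [|n ih]; first by rewrite pexp0 scale1r.
rewrite factS natrM mulrC -scalerA pexp_succ scalerDr -(lin_Z dl) ih.
rewrite /pexp big1 ?scaler0 ?addr0 // => i _.
by rewrite /= scaler0 d0 scaler0.
Qed.

Lemma pexp_comm (f : V -> V) (h : nat -> V) n : linear f ->
  (forall v, d (f v) = f (d v)) -> pexp d (f \o h) n = f (pexp d h n).
Proof.
move=> fl fd; rewrite /pexp (lin_sum fl); apply: eq_bigr => i _.
rewrite (lin_Z fl); congr (_ *: _).
have it k w : iter k d (f w) = f (iter k d w).
  by elim: k => //= k ->; rewrite fd.
exact: it.
Qed.

Lemma pexp_const_succ (v : V) n :
  (n.+1%:R : K) *: pexp d (pconst v) n.+1 = d (pexp d (pconst v) n).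
Proof.
have d0 k : iter k d 0 = 0 by exact/lin_0/lin_iter.
rewrite pexp_succ [X in _ + X]big1 ?addr0 // => i _.
by rewrite /= scaler0 d0 scaler0.
Qed.

End ExponentialSeries.

(** * The series Yt(u, x) as lambda-derivations *)

Section Ytilde.
Variables (K : numFieldType) (U : lmodType K).
Notation A := (fdalg U).
Notation der := (@fd_der K U).
Let derP : is_derivation der := fd_der_derivation U.
Let der_lin : linear der := derP.1.
Variables (Y0 : U -> U -> int -> A) (Yt : U -> int -> A -> A).
Hypothesis YtP : is_Ytilde (@fd_in K U) der Y0 Yt.

(** Coefficient of x1^n in the defining relation, where e^(x1 d) v contributes d^n v / n!. *)
Lemma Ytilde_iter u v m n : Yt u m (iter n der (fd_in v)) = (n`!%:R : K) *:
  pexp (fun f : int -> A => der \o f)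
    (pexp (fun f : int -> A => - ddx f) (pconst (Y0 u v))) n m.
Proof.
have [Yd _ /(_ v) Ye] := YtP u; have Yl := (Yd m).1.
by rewrite -(pexp_const der_lin) (lin_Z Yl) -(congr1 (fun g => g n m) Ye).
Qed.

Lemma Ytilde_in u v : (fun m => Yt u m (fd_in v)) = Y0 u v.
Proof.
apply/funext => m; rewrite -[fd_in v]/(iter 0 der (fd_in v)) Ytilde_iter.
by rewrite !pexp0 scale1r.
Qed.

(** In modes, Yt(u, x) d = (d - d/dx) Yt(u, x), which yields {u_λ (d a)} = (λ + d){u_λ a}. On
    generators it is the x1-derivative of the defining relation; the Leibniz rules carry it to
    products. *)
Lemma Ytilde_der u m a :
  Yt u m (der a) = der (Yt u m a) + m%:~R *: Yt u (m - 1) a.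
Proof.
have [Yd _ _] := YtP u.
have YD k := lin_D (Yd k).1; have YM k := (Yd k).2.
have Yc k (x : K) := derivation_alg x (Yd k).
elim/fd_ind_iter: a => [n v|x|a b ha hb|a b ha hb].
- rewrite -[der (iter n _ _)]/(iter n.+1 der (fd_in v)) !Ytilde_iter.
  set D1 := fun f : int -> A => der \o f.
  set D2 := fun f : int -> A => - ddx f.
  have D1l : linear D1.
    by move=> x f g; apply/funext => k; rewrite /D1 !fctE /= der_lin.
  have D2l : linear D2.
    move=> x f g; apply/funext => k; rewrite /D2 /ddx !fctE.
    by rewrite scalerDr opprD scalerN !scalerA mulrC.
  have D12 f : D1 (D2 f) = D2 (D1 f).
    apply/funext => k; rewrite /D1 /D2 /ddx !fctE /=.
    by rewrite (lin_N der_lin) (lin_Z der_lin).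
  set G := pexp D1 _.
  (* G = e^(x1 d) e^(-x1 d/dx) Y0(u, x) v solves dG/dx1 = (d - d/dx) G, as the two operators
     commute. *)
  have GS : (n.+1%:R : K) *: G n.+1 = D1 (G n) + D2 (G n).
    rewrite /G pexp_succ //; congr (_ + _).
    rewrite -(pexp_comm _ _ D2l D12); congr (pexp D1 _ n); apply/funext => j /=.
    by rewrite pexp_const_succ.
  rewrite factS natrM mulrC -scalerA.
  rewrite -[_ *: G n.+1 m]/((n.+1%:R *: G n.+1) m) GS /D1 /D2 /ddx !fctE /=.
  rewrite scalerDr (lin_Z der_lin); congr (_ + _).
  by rewrite -scaleNr mulrNz opprK !scalerA mulrC.
- rewrite (derivation_alg _ derP) !Yc (lin_0 (Yd m).1).
  by rewrite (lin_0 der_lin) scaler0 addr0.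
- by rewrite (lin_D der_lin) !YD ha hb (lin_D der_lin) scalerDr addrACA.
- rewrite derP.2 YD !YM ha hb (lin_D der_lin) !derP.2 !alg_scale.
  ring.
Qed.

(** This truncation makes {u_λ a} a polynomial. The bound grows by one under d, which brings in the
    mode n - 1. *)
Lemma Ytilde_finite u : (forall v, polar (Y0 u v)) ->
  forall a, exists N, forall n, (N <= n)%N -> Yt u (Posz n) a = 0.
Proof.
move=> Yp; have [Yd _ _] := YtP u.
apply: fd_ind => [v|x|a b [N hN] [P hP]|a b [N hN] [P hP]|a [N hN]].
- have [_ [N hN]] := Yp v; exists `|N|%N => n Nn.
  rewrite -[LHS]/((fun m => Yt u m (fd_in v)) (Posz n)) Ytilde_in hN //.
  by apply: le_trans (lez_abs N) _; rewrite lez_nat.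
- by exists 0%N => n _; rewrite (derivation_alg _ (Yd n)).
- exists (maxn N P) => n; rewrite geq_max => /andP[Nn Pn].
  by rewrite (lin_D (Yd n).1) hN // hP // addr0.
- exists (maxn N P) => n; rewrite geq_max => /andP[Nn Pn].
  by rewrite (Yd n).2 hN // hP // mul0r mulr0 addr0.
- exists N.+1 => -[//|n] Nn; rewrite Ytilde_der hN; last exact: ltnW.
  by rewrite -[n.+1]addn1 PoszD addrK hN // (lin_0 der_lin) scaler0 addr0.
Qed.

Lemma Ytilde_lambda u : (forall v, polar (Y0 u v)) ->
  exists T : A -> {poly A}, lambda_derivation der T /\
    forall a n, modes (T a) n = Yt u (Posz n) a.
Proof.
move=> Yp; have [Yd Yn _] := YtP u.
have /choice[T TE] : forall a, exists p : {poly A},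
    forall n, modes p n = Yt u (Posz n) a.
  by move=> a; have [N hN] := Ytilde_finite Yp a; exact: modes_exists hN.
exists T; split=> //; split=> [x a b|a b|a]; apply: modes_inj => n.
- by rewrite modesD modesZ !TE (Yd n).1.
- by rewrite modesD !modesMC !TE (Yd n).2 [a * _]mulrC.
- rewrite modes_lshift // !TE Ytilde_der; congr (_ + _).
  (* For n = 0 the indices [0.-1] and -1 differ, but both terms carry the factor 0. *)
  case: n => [|n]; first by rewrite !scale0r.
  suff -> : n.+1%:Z - 1 = n by [].
  by rewrite -addn1 PoszD addrK.
Qed.

End Ytilde.

(** * Extension of lambda-derivations from generators *)

Section LambdaExtension.
Variables (K : numFieldType) (U : lmodType K).
Notation A := (fdalg U).
Notation der := (@fd_der K U).

(** The existence of Yt is applied to an auxiliary [Y0] whose first argument is a dummy and whose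
    modes are those of X v. *)
Lemma lambda_derivation_extend (X : U -> {poly A}) :
  (forall (x : K) u v, X (x *: u + v) = x%:A *: X u + X v) ->
  exists T : A -> {poly A}, lambda_derivation der T /\
    forall u, T (fd_in u) = X u.
Proof.
move=> Xl.
pose Y0 (_ v : U) (m : int) : A := if m is Posz n then modes (X v) n else 0.
have Y0l u : linear (Y0 u).
  move=> x v w; apply/funext => -[n|n] /=.
    by rewrite Xl modesD modesZ.
  by rewrite !fctE /= scaler0 addr0.
have Y0n u v (m : int) : m < 0 -> Y0 u v m = 0 by case: m.
have [Yt [YtP _]] := Ytilde_exists_unique Y0l Y0n.
have Yp v : polar (Y0 0 v).
  split=> [m|]; first exact: Y0n.
  exists (size (X v))%:Z => -[n|//] /=; rewrite lez_nat.
  exact: modes_nil.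
have [T [TP TE]] := Ytilde_lambda YtP Yp.
exists T; split=> // u; apply: modes_inj => n; rewrite TE.
by rewrite -[LHS]/((fun m => Yt 0 m (fd_in u)) (Posz n)) (Ytilde_in YtP).
Qed.

End LambdaExtension.

(** * Uniqueness and the Jacobi identity from generators *)

Section JacobiGeneration.
Variables (K : numFieldType) (A : comAlgType K) (d : A -> A).
Hypothesis dP : is_derivation d.
Variables (U : Type) (iota : U -> A).
Hypothesis gen : diff_generated d iota.
Variable Br : A -> A -> {poly A}.
Hypothesis BrP : lambda_bracket d Br.

(** Agreement extends in the second argument; skew-symmetry exchanges the arguments, and it extends
    again. *)
Lemma lambda_bracket_uniq (Br' : A -> A -> {poly A}) : lambda_bracket d Br' ->
  (forall u v, Br (iota u) (iota v) = Br' (iota u) (iota v)) ->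
  forall a b, Br a b = Br' a b.
Proof.
move=> BrP' e a; apply: (lambda_derivation_uniq gen (BrP.1 _) (BrP'.1 _)) => u.
rewrite BrP.2 BrP'.2; congr (- skewp d _).
exact: (lambda_derivation_uniq gen (BrP.1 _) (BrP'.1 _)).
Qed.

(* Each of the three arguments is in turn moved to the last position, where the
   Jacobi identity is an equality of derivations. *)
Lemma jacobi_extend (J : eqType) (F : J -> A) :
  (forall u, exists (s : seq J) (x : J -> K),
     iota u = \sum_(j <- s) x j *: F j) ->
  (forall i j k, jacobi Br (F i) (F j) (F k)) -> forall a b c, jacobi Br a b c.
Proof.
move=> span h.
have step a b : (forall k, jacobi Br a b (F k)) -> forall c, jacobi Br a b c.
  move=> hk; apply: gen => [u|x|c c' hc hc'|c c' hc hc'|c hc].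
  - have [s [x ->]] := span u; exact: (jacobi_span BrP).
  - exact: (jacobi_const BrP).
  - by rewrite -[c]scale1r; exact: (jacobi_lin BrP).
  - exact: (jacobi_mul BrP).
  - exact: (jacobi_der dP BrP).
have h1 i a c : jacobi Br (F i) a c.
  apply: (step) => j; apply: (jacobi_swap23 dP BrP).
  exact: step.
move=> a b; apply: (step) => k; apply: (jacobi_swap23 dP BrP).
exact: (jacobi_swap12 dP BrP).
Qed.

(** The two adjacent swaps generate all permutations, so every triple can be sorted. *)
Lemma jacobi_sorted (disp : Order.disp_t) (J : orderType disp) (F : J -> A) :
  (forall i j k, (i <= j)%O -> (j <= k)%O -> jacobi Br (F i) (F j) (F k)) ->
  forall i j k, jacobi Br (F i) (F j) (F k).
Proof.
move=> h i j k.
have s12 a b c : jacobi Br a b c -> jacobi Br b a c.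
  exact: (jacobi_swap12 dP BrP).
have s23 a b c : jacobi Br a c b -> jacobi Br a b c.
  exact: (jacobi_swap23 dP BrP).
have [ij|/ltW ji] := leP i j; have [jk|/ltW kj] := leP j k.
- exact: h.
- have [ik|/ltW ki] := leP i k; first exact/s23/h.
  exact/s23/s12/h.
- have [ik|/ltW ki] := leP i k; first exact/s12/h.
  exact/s12/s23/h.
- exact/s12/s23/s12/h.
Qed.

End JacobiGeneration.

(** * Vertex Poisson structures as lambda-brackets *)

Section VertexPoissonBracket.
Variables (K : numFieldType) (A : comAlgType K) (d : A -> A).
Hypothesis dP : is_derivation d.

Lemma modesMX (p : {poly A}) n : modes (p * 'X) n = n%:R *: modes p n.-1.
Proof.
rewrite /modes coefMX; case: n => [|n] /=; first by rewrite scaler0 scale0r.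
by rewrite scalerA factS natrM.
Qed.

Lemma modesN (p : {poly A}) n : modes (- p) n = - modes p n.
Proof. by rewrite /modes coefN scalerN. Qed.

Lemma modes_lin (T : A -> {poly A}) n : lambda_derivation d T ->
  linear (fun a => modes (T a) n).
Proof. by move=> [Tl _ _] x a b; rewrite Tl modesD modesZ. Qed.

(** (C0) holds because brackets are polynomials; (C1) is sesquilinearity, (C2) skew-symmetry and
    (C3) the Jacobi identity. *)
Lemma lambda_bracket_vertex_poisson (Br : A -> A -> {poly A}) :
  lambda_bracket d Br -> (forall a b c, jacobi Br a b c) ->
  vertex_poisson d (fun n a b => modes (Br a b) n).
Proof.
move=> BrP BrJ; split=> // [|n a b c].
  split=> [|n b|n a|a b|n a b|n a b|m n a b c].
  - exact: dP.1.
  - by move=> x a c; rewrite (lambda_linl dP BrP) modesD modesZ.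
  - exact/modes_lin/BrP.1.
  - by exists (size (Br a b)) => n; exact: modes_nil.
  - by rewrite (lambda_sesqui dP BrP) modesN modesMX scaleNr.
  - by rewrite BrP.2 modes_skew.
  - by move: m n; apply/(jacobi_modesP dP BrP).
by have [_ -> _] := BrP.1 a; rewrite modesD !modesMC [b * _]mulrC.
Qed.

Lemma vertex_poisson_lambda_bracket (prod : nat -> A -> A -> A) :
  vertex_poisson d prod -> exists Br : A -> A -> {poly A},
    lambda_bracket d Br /\ forall n a b, prod n a b = modes (Br a b) n.
Proof.
move=> [_ [_ _ linr C0 C1 C2 _] leib].
have /choice[B BE] : forall x : A * A, exists p : {poly A},
    forall n, modes p n = prod n x.1 x.2.
  by move=> [a b]; have [N hN] := C0 a b; exact: modes_exists hN.
pose Br a b := B (a, b).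
have Bm a b n : modes (Br a b) n = prod n a b by exact: BE.
have sk a b : Br b a = - skewp d (Br a b).
  apply: modes_inj => n; rewrite Bm C2 modes_skew //.
  by under [RHS]eq_fsbigr do rewrite Bm.
have sl a b : Br (d a) b = - (Br a b * 'X).
  by apply: modes_inj => n; rewrite modesN modesMX !Bm C1 scaleNr.
exists Br; split=> //; split=> // a; split=> [x b c|b c|b].
- by apply: modes_inj => n; rewrite modesD modesZ !Bm linr.
- by apply: modes_inj => n; rewrite modesD !modesMC !Bm leib [b * _]mulrC.
(* The rule for d in the second argument follows from (C1) by skew-symmetry. *)
- rewrite sk sl skewN // opprK skewMX //.
  by rewrite [Br a b]sk lshiftN.
Qed.

End VertexPoissonBracket.

(** * The commutator identity as a Jacobi identity *)

Section CommutatorIdentity.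
Variables (K : numFieldType) (A : comAlgType K) (d : A -> A).
Hypothesis dP : is_derivation d.

Lemma NegzB1 (n : nat) : - n%:Z - 1 = Negz n.
Proof. by rewrite NegzE -addn1 PoszD opprD. Qed.

Lemma signz (n : nat) : (-1 : K) ^ (- n%:Z - 1) = (-1) ^+ n.+1.
Proof.
by rewrite NegzB1 -[LHS]/(((-1) ^+ n.+1)^-1) invr_sign.
Qed.

(** Each factor -r-1-i is -(r+1+i), so multiplying by r! completes the product to (r+j)! up to
    sign. *)
Lemma gbinom_neg (r j : nat) :
  gbinom (- r%:Z - 1)%:~R j = (-1) ^+ j * 'C(r + j, j)%:R :> K.
Proof.
have main : (\prod_(i < j) ((- r%:Z - 1)%:~R - i%:R)) * r`!%:R =
    (-1) ^+ j * (r + j)`!%:R :> K.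
  elim: j => [|j ih]; first by rewrite big_ord0 addn0.
  rewrite big_ord_recr /= mulrAC ih addnS factS exprS natrM -addn1 !natrD.
  rewrite intrB intrN /=; ring.
rewrite /gbinom; apply: (mulIf (fact_unit K r)); rewrite mulrAC main.
rewrite -(bin_fact (leq_addl r j)) addnK !natrM.
by field; rewrite fact_unit.
Qed.

(** The signs of (-x2)^j and of the negative binomial cancel. *)
Lemma xsub_Negz (f : int -> A) (m j : nat) : (j <= m)%N ->
  xsub f m (Negz j) = 'C(m, j)%:R *: f (m - j)%N.
Proof.
move=> jm; rewrite /= subzn // gbinom_neg subnK // mulrA -expr2 sqrr_sign.
by rewrite mul1r.
Qed.

Lemma xsub_eq0 (f : int -> A) (m : nat) (n : int) :
  (forall k, k < 0 -> f k = 0) -> (0 <= n) || (n < - m.+1%:Z) ->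
  xsub f m n = 0.
Proof.
move=> f0; case: n => [//|j] /=; rewrite NegzE ltrN2 ltz_nat => mj.
by rewrite f0 ?scaler0 // subr_lt0 ltz_nat.
Qed.

(* The [x1^(-m-1) x2^(-q-1)] coefficient of [T(w,-x2) f(x1 - x2)]. *)
Lemma xapp2_xneg_xsub (T : int -> A -> A) (f : int -> A) (m q : nat) :
  (forall k, T k 0 = 0) ->
  (forall k, k < 0 -> f k = 0) -> (forall k, k < 0 -> T k = 0) ->
  (forall k x a, T k (x *: a) = x *: T k a) ->
  xapp2 (xneg T) (xsub f) m q = \sum_(p < m.+1)
    ((-1) ^+ (q + (m - p) + 1) * 'C(m, p)%:R) *: T (q + (m - p))%N (f p).
Proof.
move=> T0 f0 Tn TZ; rewrite /xapp2.
(* Only k = q + j with 0 <= j <= m contributes: then q - k - 1 is [Negz j], the mode of x2^j. *)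
rewrite (fsbigE [seq (q + j)%N%:Z | j <- index_iota 0 m.+1]) //.
- rewrite big_map big_mkord (reindex_inj rev_ord_inj) /=.
  under eq_bigl do rewrite in_setT.
  apply: eq_bigr => p _; have pm : (p <= m)%N by rewrite -ltnS.
  rewrite subSS.
  have -> : q%:Z - (q + (m - p))%N%:Z - 1 = Negz (m - p).
    by rewrite PoszD opprD addrA subrr add0r NegzB1.
  rewrite xsub_Negz ?leq_subr // subKn // bin_sub //.
  by rewrite /xneg fctE TZ signz scalerA addn1.
- rewrite map_inj_uniq ?iota_uniq // => j k /eqP.
  by rewrite eqz_nat eqn_add2l => /eqP.
- move=> k _ kr; case: k kr => [k|k] kr; last first.
    by rewrite /xneg fctE Tn // scaler0.
  rewrite /xneg fctE xsub_eq0 ?T0 ?scaler0 //.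
  have [kq|qk] := ltnP k q.
    by rewrite -addrA -opprD subr_ge0 -PoszD lez_nat addn1 kq.
  apply/orP; right.
  have mk : (m < k - q)%N.
    rewrite ltnNge; apply: contra kr => km; apply/mapP; exists (k - q)%N.
      by rewrite mem_index_iota.
    by rewrite subnKC.
  rewrite -[q%:Z - _]opprB subzn // -opprD ltrN2 -[1]/(Posz 1) -PoszD addn1.
  by rewrite ltz_nat.
Qed.

(** At x1^(-m-1) x2^(-n-1), the factor e^(x2 d) and the argument -x2 together implement
    skew-symmetry, so the right side becomes that of (C3). *)
Lemma commutator_identity_jacobi (U : lmodType K) (iota : U -> A)
    (Br : A -> A -> {poly A}) (Y0 : U -> U -> int -> A)
    (Yt : U -> int -> A -> A) (u v w : U) :
  lambda_bracket d Br ->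
  (forall u v n, Y0 u v (Posz n) = modes (Br (iota u) (iota v)) n) ->
  (forall u v k, k < 0 -> Y0 u v k = 0) ->
  (forall u n a, Yt u (Posz n) a = modes (Br (iota u) a) n) ->
  (forall u k, k < 0 -> Yt u k = 0) ->
  commutator_identity d Y0 Yt u v w -> jacobi Br (iota u) (iota v) (iota w).
Proof.
move=> BrP Y0E Y0n YtE Ytn cid; apply/(jacobi_modesP dP BrP) => m n.
have it i : linear (iter i d) by exact/lin_iter/dP.1.
have YtZ k x a : Yt w k (x *: a) = x *: Yt w k a.
  case: k => k; last by rewrite Ytn // scaler0.
  by rewrite !YtE (lin_Z (modes_lin k (BrP.1 _))).
have Yt0 k : Yt w k 0 = 0 by have := YtZ k 0 0; rewrite !scale0r.
have /(congr1 (fun g => g (Posz m) (Posz n))) := cid.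
rewrite !YtE !Y0E => ->; rewrite /Sing2 /= /expx.
pose x p := modes (Br (iota u) (iota v)) p.
(* A bound common to all p, which truncates both infinite sums to i < N. *)
pose N := \max_(p < m.+1) size (Br (iota w) (x p)).
have Nx (p : 'I_m.+1) k : (N <= k)%N -> modes (Br (iota w) (x p)) k = 0.
  move=> Nk; apply/modes_nil/(leq_trans _ Nk).
  exact: (leq_bigmax (F := fun p : 'I_m.+1 => size (Br (iota w) (x p)))).
under eq_fsbigr => i _.
  rewrite -PoszD (xapp2_xneg_xsub _ _ Yt0 (Y0n u v) (Ytn w) YtZ).
  under eq_bigr do rewrite Y0E YtE -/(x _).
  over.
rewrite (fsbig_nat_ord (N := N)); last first.
  move=> i Ni; rewrite big1 ?(lin_0 (it i)) ?scaler0 // => p _.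
  by rewrite Nx ?scaler0 // (leq_trans Ni) // addnAC leq_addl.
apply: (etrans (eq_bigr _ _)).
  by move=> i _; rewrite (lin_sum (it i)) scaler_sumr; reflexivity.
(* After the exchange, the sum over i is, up to C(m, p), the expansion (C2) of the product of u_p v
   and w with index m + n - p. *)
rewrite exchange_big /=; apply: eq_bigr => p _.
have pm : (p <= m)%N by rewrite -ltnS.
rewrite -/(x p) [Br (x p) _]BrP.2 modes_skew //.
rewrite (fsbig_nat_ord (N := N)) => [|i Ni]; last first.
  by rewrite Nx ?(lin_0 (it i)) ?scaler0 // (leq_trans Ni) // leq_addl.
rewrite scaler_sumr; apply: eq_bigr => i _.
rewrite (lin_Z (it i)) !scalerA.
have -> : (n + i + (m - p) = m + n - p + i)%N.
  by rewrite -[(m + n - p)%N]addnBAC // addnC addnA.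
by congr (_ *: _); ring.
Qed.

End CommutatorIdentity.

(** * Existence and uniqueness of the extension *)

Section Extension.
Variables (K : numFieldType) (U : lmodType K) (A : comAlgType K) (d : A -> A).
Hypothesis dP : is_derivation d.
Variable iota : U -> A.
Hypothesis iota_lin : linear iota.
Hypothesis gen : diff_generated d iota.
Hypothesis extend : forall X : U -> {poly A},
  (forall (x : K) u v, X (x *: u + v) = x%:A *: X u + X v) ->
  exists T : A -> {poly A}, lambda_derivation d T /\
    forall u, T (iota u) = X u.

Lemma lambda_derivation_comb (x : K) (T T' : A -> {poly A}) :
  lambda_derivation d T -> lambda_derivation d T' ->
  lambda_derivation d (fun a => x%:A *: T a + T' a).
Proof.
move=> [Tl TM Td] [Tl' TM' Td']; split=> [y a b|a b|a].
- rewrite Tl Tl' !scalerDr !scalerA [y%:A * _]mulrC.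
  by rewrite -!addrA; congr (_ + _); rewrite addrCA.
- rewrite TM TM' scalerDr !mulrDl -!scalerAl -!addrA; congr (_ + _).
  by rewrite addrCA.
- rewrite Td Td' lshiftD //; congr (_ + _).
  rewrite /lshift scalerDr scalerAl; congr (_ + _); apply/polyP => n.
  by rewrite coefZ !(coef_map_lin dP.1) coefZ !mulr_algl (lin_Z dP.1).
Qed.

Lemma weak_pre_vertex_poisson_bracket (Y0 : U -> U -> int -> A)
    (L : U -> A -> {poly A}) :
  weak_pre_vertex_poisson d Y0 -> (forall u, lambda_derivation d (L u)) ->
  (forall u v n, modes (L u (iota v)) n = Y0 u v (Posz n)) ->
  exists Br : A -> A -> {poly A}, lambda_bracket d Br /\
    forall u a, Br (iota u) a = L u a.
Proof.
move=> [wl wr wp ws] LP LE.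
have Ll x u v a : L (x *: u + v) a = x%:A *: L u a + L v a.
  apply: (lambda_derivation_uniq gen (LP _)
    (lambda_derivation_comb x (LP u) (LP v))).
  by move=> w; apply: modes_inj => n; rewrite modesD modesZ !LE wl.
(* The skew-symmetry of [Y0], read in modes, is (C2) on generators. *)
have Lsk u v : L u (iota v) = - skewp d (L v (iota u)).
  apply: modes_inj => n; rewrite LE modes_skew // ws /Sing /= /expx.
  apply: eq_fsbigr => i _; rewrite /xneg LE -PoszD signz.
  by rewrite (lin_Z (lin_iter i dP.1)) scalerA mulrC addn1.
(* Skew-symmetry forces the values {a_λ u}, which extend to a lambda-derivation. *)
have /choice[Br BrE] : forall a, exists T : A -> {poly A},
    lambda_derivation d T /\ forall u, T (iota u) = - skewp d (L u a).
  move=> a; apply: extend => x u v.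
  by rewrite Ll skewD // skewZ // opprD -scalerN.
have BrL u a : Br (iota u) a = L u a.
  apply: (lambda_derivation_uniq gen (BrE _).1 (LP u)).
  by move=> v; rewrite (BrE _).2 -Lsk.
exists Br; split=> //; apply: (lambda_bracket_gen dP gen) => [a|a u].
  by case: (BrE a).
by rewrite BrL (BrE a).2.
Qed.


Lemma vertex_poisson_extension (disp : Order.disp_t) (J : orderType disp)
    (e : J -> U) (Y0 : U -> U -> int -> A) (Yt : U -> int -> A -> A) :
  is_basis e -> weak_pre_vertex_poisson d Y0 ->
  (forall u, exists T : A -> {poly A}, lambda_derivation d T /\
    forall a n, modes (T a) n = Yt u (Posz n) a) ->
  (forall u v, (fun m => Yt u m (iota v)) = Y0 u v) ->
  (forall u k, k < 0 -> Yt u k = 0) ->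
  (forall i j k : J, (i <= j)%O -> (j <= k)%O ->
     commutator_identity d Y0 Yt (e i) (e j) (e k)) ->
  exists! prod : nat -> A -> A -> A, vertex_poisson d prod /\
    (forall u v : U, Yminus prod (iota u) (iota v) = Y0 u v).
Proof.
move=> [_ span] wp /choice[L LP] Ytin Ytn comm.
have Y0n u v k : k < 0 -> Y0 u v k = 0.
  by case: wp => _ _ /(_ u v)[+ _] _; exact.
have LE u v n : modes (L u (iota v)) n = Y0 u v (Posz n).
  by rewrite (LP u).2 -Ytin.
have [Br [BrP BrL]] :=
  weak_pre_vertex_poisson_bracket wp (fun u => (LP u).1) LE.
have BrE u v n : modes (Br (iota u) (iota v)) n = Y0 u v (Posz n).
  by rewrite BrL.
have BrJ : forall a b c, jacobi Br a b c.
  apply: (jacobi_extend dP gen BrP (F := iota \o e)) => [u|].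
    have [s [x ->]] := span u; exists s, x; rewrite (lin_sum iota_lin).
    by apply: eq_bigr => j _; rewrite (lin_Z iota_lin).
  apply: (jacobi_sorted dP BrP) => i j k ij jk.
  apply: (commutator_identity_jacobi dP BrP _ Y0n _ Ytn (comm i j k ij jk)).
    by move=> u v n; rewrite BrE.
  by move=> u n a; rewrite BrL (LP u).2.
exists (fun n a b => modes (Br a b) n); split.
  split=> [|u v]; first exact: lambda_bracket_vertex_poisson.
  by apply/funext => -[n|n] /=; rewrite ?BrE // Y0n.
(* Any other extension comes from a lambda-bracket with the same values on pairs of generators. *)
move=> prod [/(vertex_poisson_lambda_bracket dP)[Br' [BrP' prodE]] Yp].
apply/funext => n; apply/funext => a; apply/funext => b; rewrite prodE.
congr modes; apply: (lambda_bracket_uniq gen BrP BrP') => u v.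
by apply: modes_inj => k; rewrite BrE -prodE -Yp.
Qed.

End Extension.

Theorem theorem3p11 (R : realType) (U : lmodType R[i])
    (disp : Order.disp_t) (I : orderType disp) (e : I -> U)
    (Y0 : U -> U -> int -> fdalg U)
    (Yt : U -> int -> fdalg U -> fdalg U) :
  is_basis e ->
  weak_pre_vertex_poisson (@fd_der _ U) Y0 ->
  is_Ytilde (@fd_in _ U) (@fd_der _ U) Y0 Yt ->
  (forall i j k : I, (i <= j)%O -> (j <= k)%O ->
     commutator_identity (@fd_der _ U) Y0 Yt (e i) (e j) (e k)) ->
  exists! prod : nat -> fdalg U -> fdalg U -> fdalg U,
    vertex_poisson (@fd_der _ U) prod /\
    (forall u v : U, Yminus prod (fd_in u) (fd_in v) = Y0 u v).
Proof.
move=> eP wp YtP comm.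
have fd_in_lin : linear (@fd_in _ U) by move=> x u v; rewrite /fd_in !linearP.
apply: (vertex_poisson_extension (fd_der_derivation U) fd_in_lin (@fd_ind _ U)
  (@lambda_derivation_extend _ U) eP wp _ _ _ comm).
- move=> u; apply: (Ytilde_lambda YtP) => v.
  by case: wp => _ _ /(_ u v).
- exact: Ytilde_in YtP.
- by move=> u k; case: (YtP u) => _ /(_ k).
Qed.
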